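(* Let $p$ be a prime, $n\ge1$ an integer and $\alpha\in\mathbb{R}$. Suppose that $1<q<\infty$, $\frac1q+\frac1{q'}=1$, and $b\in CMO^{\max\{q',q\}}(\mathbb{Q}_p^n)$. Then: (1) if $\alpha<\frac{nq}{q'}$, then $\mathcal{H}^p_b$ is bounded from $L^q(|x|_p^{\alpha}dx)$ to $L^q(|x|_p^{\alpha}dx)$; (2) if $\alpha>-n$, then $\mathcal{H}^{p,*}_b$ is bounded from $L^q(|x|_p^{\alpha}dx)$ to $L^q(|x|_p^{\alpha}dx)$.
   Context: $\mathbb{Q}_p$ is the field of $p$-adic numbers with norm $|\cdot|_p$ normalized by $|p|_p=p^{-1}$; on $\mathbb{Q}_p^n$ one sets $|x|_p=\max_{1\le j\le n}|x_j|_p$. $dx$ is the Haar measure on $\mathbb{Q}_p^n$ normalized so that $\{x:|x|_p\le 1\}$ has measure $1$; $|E|_H$ is the Haar measure of $E$. $B_\gamma=\{x\in\mathbb{Q}_p^n:|x|_p\le p^\gamma\}$ for $\gamma\in\mathbb{Z}$, and $B(0,|x|_p)=\{t\in\mathbb{Q}_p^n:|t|_p\le|x|_p\}$. The $p$-adic Hardy operators are, for $x\in\mathbb{Q}_p^n\setminus\{0\}$, $$\mathcal{H}^pf(x)=\frac{1}{|x|_p^n}\int_{B(0,|x|_p)}f(t)\,dt,\qquad \mathcal{H}^{p,*}f(x)=\int_{\mathbb{Q}_p^n\setminus B(0,|x|_p)}\frac{f(t)}{|t|_p^n}\,dt.$$ For a locally integrable $b$ on $\mathbb{Q}_p^n$,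 their commutators are $$\mathcal{H}^p_bf=b\,\mathcal{H}^pf-\mathcal{H}^p(bf),\qquad \mathcal{H}^{p,*}_bf=b\,\mathcal{H}^{p,*}f-\mathcal{H}^{p,*}(bf).$$ For $1\le s<\infty$, $CMO^s(\mathbb{Q}_p^n)$ is the set of $f\in L^s_{loc}(\mathbb{Q}_p^n)$ with $$\|f\|_{CMO^s(\mathbb{Q}_p^n)}=\sup_{\gamma\in\mathbb{Z}}\left(\frac{1}{|B_\gamma|_H}\int_{B_\gamma}|f(x)-f_{B_\gamma}|^s\,dx\right)^{1/s}<\infty,\qquad f_{B_\gamma}=\frac{1}{|B_\gamma|_H}\int_{B_\gamma}f(x)\,dx.$$ $L^q(|x|_p^\alpha dx)$ is the weighted Lebesgue space on $\mathbb{Q}_p^n$ with norm $\left(\int_{\mathbb{Q}_p^n}|f(x)|^q|x|_p^\alpha dx\right)^{1/q}$. An operator $A$ is bounded from $X$ to $Y$ if there is a constant $C$ (independent of $f$) with $\|Af\|_Y\le C\|f\|_X$ for all $f\in X$. *)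

(* Defs.v *)
From HB Require Import structures.
From mathcomp Require Import all_boot all_order all_algebra.
From mathcomp Require Import generic_quotient ring_quotient.
From mathcomp Require Import zify ring lra.
From mathcomp Require Import all_classical all_reals all_analysis.

Set Implicit Arguments.
Unset Strict Implicit.
Unset Printing Implicit Defensive.

Import Order.TTheory GRing.Theory Num.Theory.
Local Open Scope classical_set_scope.
Local Open Scope ring_scope.

(** ** The p-adic absolute value on the rationals *)

Section rat_padic.
Variable p : nat.

Definition padic_val (x : rat) : int :=
  (logn p `|numq x|)%:Z - (logn p `|denq x|)%:Z.

Definition rat_padic_abs (x : rat) : rat :=
  if x == 0 then 0 else p%:Q ^ (- padic_val x).

Hypothesis pr : prime p.

Let p_gt0 : 0 < p%:Q. Proof. by rewrite ltr0n prime_gt0. Qed.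
Let p_ge1 : 1 <= p%:Q. Proof. by rewrite ler1n prime_gt0. Qed.
Let p_gt1 : 1 < p%:Q. Proof. by rewrite ltr1n prime_gt1. Qed.

Lemma padic_valE (a b : int) : a != 0 -> b != 0 ->
  padic_val (a%:Q / b%:Q) = (logn p `|a|)%:Z - (logn p `|b|)%:Z.
Proof.
move=> a0 b0; set x := a%:Q / b%:Q.
have bq0 : b%:Q != 0 by rewrite intr_eq0.
have x0 : x != 0 by rewrite mulf_neq0 ?invr_eq0 ?intr_eq0.
have nx0 : numq x != 0 by rewrite numq_eq0.
have dx0 := denq_neq0 x.
have E : a * denq x = numq x * b.
  apply: (@intr_inj rat); rewrite !intrM.
  have /eqP := divq_num_den x; rewrite {3}/x eqr_div ?intr_eq0 //.
  by move/eqP => ->.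
have := congr1 (fun z : int => logn p `|z|%N) E.
rewrite /= !abszM !lognM ?absz_gt0 // /padic_val; lia.
Qed.

Lemma rat_padic_abs0 : rat_padic_abs 0 = 0.
Proof. by rewrite /rat_padic_abs eqxx. Qed.

Lemma rat_padic_abs_gt0 x : x != 0 -> 0 < rat_padic_abs x.
Proof. by rewrite /rat_padic_abs => /negbTE ->; rewrite exprz_gt0. Qed.

Lemma rat_padic_abs_ge0 x : 0 <= rat_padic_abs x.
Proof.
have [->|/rat_padic_abs_gt0/ltW//] := eqVneq x 0; by rewrite rat_padic_abs0.
Qed.

Lemma rat_padic_abs_eq0 x : (rat_padic_abs x == 0) = (x == 0).
Proof.
have [->|x0] := eqVneq x 0; first by rewrite rat_padic_abs0 eqxx.
by rewrite gt_eqF // rat_padic_abs_gt0.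
Qed.

Lemma rat_padic_absM x y :
  rat_padic_abs (x * y) = rat_padic_abs x * rat_padic_abs y.
Proof.
have [->|x0] := eqVneq x 0; first by rewrite mul0r rat_padic_abs0 mul0r.
have [->|y0] := eqVneq y 0; first by rewrite mulr0 rat_padic_abs0 mulr0.
rewrite /rat_padic_abs mulf_eq0 (negbTE x0) (negbTE y0) /=.
rewrite -expfzDr ?gt_eqF//; congr (_ ^ _).
have nx0 : numq x != 0 by rewrite numq_eq0.
have ny0 : numq y != 0 by rewrite numq_eq0.
have -> : x * y = (numq x * numq y)%:Q / (denq x * denq y)%:Q.
  by rewrite -{1}(divq_num_den x) -{1}(divq_num_den y) !intrM mulf_div.
rewrite padic_valE ?mulf_neq0 ?denq_neq0 //.
rewrite !abszM !lognM ?absz_gt0 ?denq_neq0 // /padic_val; lia.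
Qed.

Lemma rat_padic_abs1 : rat_padic_abs 1 = 1.
Proof.
rewrite /rat_padic_abs oner_eq0.
have -> : (1 : rat) = 1%:Q / 1%:Q by rewrite divr1.
by rewrite padic_valE // subrr.
Qed.

Lemma rat_padic_absN x : rat_padic_abs (- x) = rat_padic_abs x.
Proof.
rewrite /rat_padic_abs oppr_eq0; case: eqP => // /eqP x0; congr (_ ^ - _).
by rewrite /padic_val numqN denqN abszN.
Qed.

Lemma rat_padic_absV x : rat_padic_abs x^-1 = (rat_padic_abs x)^-1.
Proof.
have [->|x0] := eqVneq x 0; first by rewrite !(invr0, rat_padic_abs0).
have nx0 : rat_padic_abs x != 0 by rewrite rat_padic_abs_eq0.
by apply: (mulfI nx0); rewrite -rat_padic_absM !divff // rat_padic_abs1.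
Qed.

Lemma rat_padic_abs_prime : rat_padic_abs p%:Q = p%:Q^-1.
Proof.
rewrite /rat_padic_abs gt_eqF //.
have -> : p%:Q = p%:Q / 1%:Q by rewrite divr1.
rewrite padic_valE // ?eqz_nat -?lt0n ?prime_gt0 //.
by rewrite /= logn_prime // eqxx logn1 subr0 divr1.
Qed.

Lemma rat_padic_absD x y :
  rat_padic_abs (x + y) <= Num.max (rat_padic_abs x) (rat_padic_abs y).
Proof.
have [->|x0] := eqVneq x 0; first by rewrite add0r le_max lexx orbT.
have [->|y0] := eqVneq y 0; first by rewrite addr0 le_max lexx.
have [xy0|xy0] := eqVneq (x + y) 0.
  by rewrite xy0 rat_padic_abs0 le_max rat_padic_abs_ge0.
have nx0 : numq x != 0 by rewrite numq_eq0.
have ny0 : numq y != 0 by rewrite numq_eq0.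
have dx0 := denq_neq0 x; have dy0 := denq_neq0 y.
have dd0 : denq x * denq y != 0 by rewrite mulf_neq0.
pose A := numq x * denq y; pose B := numq y * denq x.
have A0 : A != 0 by rewrite mulf_neq0.
have B0 : B != 0 by rewrite mulf_neq0.
have Ex : x = A%:Q / (denq x * denq y)%:Q.
  rewrite -{1}(divq_num_den x) !intrM -mulf_div divff ?mulr1 //.
  by rewrite intr_eq0.
have Ey : y = B%:Q / (denq x * denq y)%:Q.
  rewrite -{1}(divq_num_den y) !intrM [(denq x)%:~R * _]mulrC -mulf_div divff ?mulr1 //.
  by rewrite intr_eq0.
have Exy : x + y = (A + B)%:Q / (denq x * denq y)%:Q.
  by rewrite intrD mulrDl -Ex -Ey.
have AB0 : A + B != 0.
  by apply: contra xy0 => /eqP e; rewrite Exy e mul0r.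
pose d := (logn p `|denq x * denq y|)%:Z.
have vx : padic_val x = (logn p `|A|)%:Z - d by rewrite {1}Ex padic_valE.
have vy : padic_val y = (logn p `|B|)%:Z - d by rewrite {1}Ey padic_valE.
have vxy : padic_val (x + y) = (logn p `|A + B|)%:Z - d.
  by rewrite Exy padic_valE.
rewrite /rat_padic_abs (negbTE x0) (negbTE y0) (negbTE xy0) vx vy vxy.
set k := minn (logn p `|A|) (logn p `|B|).
have kAB : (k <= logn p `|(A + B)%R|)%N.
  rewrite -pfactor_dvdn ?absz_gt0 //.
  have hA : (p ^ k %| `|A|)%N by rewrite pfactor_dvdn ?absz_gt0 // geq_minl.
  have hB : (p ^ k %| `|B|)%N by rewrite pfactor_dvdn ?absz_gt0 // geq_minr.
  have : ((p ^ k)%N%:Z %| A + B)%Z by apply: rpredD; rewrite dvdzE.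
  by rewrite dvdzE.
rewrite le_max; apply/orP.
have [h|h] := leqP (logn p `|A|) (logn p `|B|).
  by left; rewrite ler_weXz2l //; move: kAB; rewrite /k; lia.
by right; rewrite ler_weXz2l //; move: kAB; rewrite /k; lia.
Qed.

Lemma rat_padic_absB x y :
  rat_padic_abs (x - y) <= Num.max (rat_padic_abs x) (rat_padic_abs y).
Proof. by rewrite -(rat_padic_absN y) rat_padic_absD. Qed.

End rat_padic.

(** ** The field of p-adic numbers, as the completion of the rationals *)

Definition padic_cauchy (p : nat) (u : nat -> rat) : Prop :=
  forall e : rat, 0 < e -> exists N, forall i j,
    (N <= i)%N -> (N <= j)%N -> rat_padic_abs p (u i - u j) < e.

Definition padic_null (p : nat) (u : nat -> rat) : Prop :=
  forall e : rat, 0 < e -> exists N, forall i,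
    (N <= i)%N -> rat_padic_abs p (u i) < e.

(* [c] is the limit of the p-adic absolute values of the terms of [u]. *)
Definition padic_abs_lim (p : nat) (u : nat -> rat) (c : rat) : Prop :=
  forall e : rat, 0 < e -> exists N, forall i,
    (N <= i)%N -> `|c - rat_padic_abs p (u i)| < e.

(* The primality proof is an argument so that the ring instances below can be
   inferred from it. *)
Definition cauchy_pred (p : nat) (pr : prime p) : {pred nat -> rat} :=
  fun u => `[< padic_cauchy p u >].

Section cauchy_sequences.
Variables (p : nat) (pr : prime p).
Local Notation pabs := (rat_padic_abs p).

Lemma padic_cauchy_bounded u : padic_cauchy p u ->
  exists N, exists2 M, 0 < M & forall i, (N <= i)%N -> pabs (u i) <= M.
Proof.
move=> /(_ 1 ltr01)[N hN]; exists N; exists (Num.max 1 (pabs (u N))).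
  by rewrite lt_max ltr01.
move=> i iN; rewrite -(subrK (u N) (u i)).
apply: le_trans (rat_padic_absD pr _ _) _.
by rewrite ge_max !le_max lexx orbT (ltW (hN _ _ iN (leqnn _))).
Qed.

Lemma cauchy_subring_closed : subring_closed (cauchy_pred pr).
Proof.
split.
- apply/asboolP => e e0; exists 0%N => i j _ _.
  by rewrite /= subrr rat_padic_abs0.
- move=> u v /asboolP hu /asboolP hv; apply/asboolP => e e0.
  have [N1 h1] := hu _ e0; have [N2 h2] := hv _ e0.
  exists (maxn N1 N2) => i j; rewrite !geq_max => /andP[i1 i2] /andP[j1 j2].
  have -> : (u - v) i - (u - v) j = (u i - u j) - (v i - v j).
    by rewrite -![(u - v) _]/(u _ - v _); ring.
  by apply: le_lt_trans (rat_padic_absB pr _ _) _; rewrite gt_max h1 ?h2.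
- move=> u v /asboolP hu /asboolP hv; apply/asboolP => e e0.
  have [Nu [Mu Mu0 bu]] := padic_cauchy_bounded hu.
  have [Nv [Mv Mv0 bv]] := padic_cauchy_bounded hv.
  have [N1 h1] := hu _ (divr_gt0 e0 Mv0); have [N2 h2] := hv _ (divr_gt0 e0 Mu0).
  exists (maxn (maxn Nu Nv) (maxn N1 N2)) => i j.
  rewrite !geq_max => /andP[/andP[i1 i2] /andP[i3 i4]].
  move=> /andP[/andP[j1 j2] /andP[j3 j4]].
  have -> : (u * v) i - (u * v) j = (u i - u j) * v i + u j * (v i - v j).
    by rewrite -![(u * v) _]/(u _ * v _); ring.
  apply: le_lt_trans (rat_padic_absD pr _ _) _.
  rewrite gt_max !rat_padic_absM //; apply/andP; split.
    apply: (@le_lt_trans _ _ (pabs (u i - u j) * Mv)).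
      by rewrite ler_wpM2l ?rat_padic_abs_ge0 ?bv.
    by rewrite -ltr_pdivlMr // h1.
  apply: (@le_lt_trans _ _ (Mu * pabs (v i - v j))).
    by rewrite ler_wpM2r ?rat_padic_abs_ge0 ?bu.
  by rewrite mulrC -ltr_pdivlMr // h2.
Qed.

HB.instance Definition _ :=
  GRing.isSubringClosed.Build _ (cauchy_pred pr) cauchy_subring_closed.

Record cauchy_seq := CauchySeq {
  cauchy_val :> nat -> rat;
  _ : cauchy_val \in cauchy_pred pr }.

HB.instance Definition _ := [isSub for cauchy_val].
HB.instance Definition _ := [Choice of cauchy_seq by <:].
HB.instance Definition _ := [SubChoice_isSubComNzRing of cauchy_seq by <:].

Lemma cauchy_seqP (u : cauchy_seq) : padic_cauchy p u.
Proof. by case: u => u /= /asboolP. Qed.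

Definition null_pred : {pred cauchy_seq} := fun u => `[< padic_null p u >].

Lemma null_idealr_closed : idealr_closed null_pred.
Proof.
split.
- apply/asboolP => e e0; exists 0%N => i _.
  by rewrite -[X in _ (X i)]/(0 : nat -> rat) /= rat_padic_abs0.
- apply/asboolP => /(_ 1 ltr01)[N /(_ _ (leqnn N))].
  by rewrite [cauchy_val _]/= rat_padic_abs1 // ltxx.
- move=> a u v /asboolP hu /asboolP hv; apply/asboolP => e e0.
  have [Na [M M0 ba]] := padic_cauchy_bounded (cauchy_seqP a).
  have [N1 h1] := hu _ (divr_gt0 e0 M0); have [N2 h2] := hv _ e0.
  exists (maxn Na (maxn N1 N2)) => i; rewrite !geq_max => /and3P[ia i1 i2].
  have -> : cauchy_val (a * u + v) i = a i * u i + v i by [].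
  apply: le_lt_trans (rat_padic_absD pr _ _) _; rewrite gt_max h2 // andbT.
  rewrite rat_padic_absM //; apply: (@le_lt_trans _ _ (M * pabs (u i))).
    by rewrite ler_wpM2r ?rat_padic_abs_ge0 ?ba.
  by rewrite mulrC -ltr_pdivlMr // h1.
Qed.

HB.instance Definition _ :=
  isIdealr.Build _ null_pred null_idealr_closed.

(* Cauchy sequences of rationals modulo null sequences. *)
Definition Qp := {ideal_quot null_pred}.

HB.instance Definition _ := GRing.ComNzRing.on Qp.

Lemma padic_cauchy_nonnull u : padic_cauchy p u -> ~ padic_null p u ->
  exists N, exists2 c, 0 < c & forall i, (N <= i)%N -> pabs (u i) = c.
Proof.
move=> cu /existsNP[e /not_implyP[e0 /forallNP hN]].
have [N h] := cu _ e0.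
have /existsNP[k /not_implyP[Nk /negP]] := hN N; rewrite -leNgt => ek.
exists N; exists (pabs (u k)); first exact: lt_le_trans ek.
move=> i Ni; apply/eqP; rewrite eq_le; apply/andP; split.
  rewrite -(subrK (u k) (u i)); apply: le_trans (rat_padic_absD pr _ _) _.
  by rewrite ge_max lexx andbT (le_trans (ltW (h _ _ Ni Nk))).
have := rat_padic_absD pr (u k - u i) (u i); rewrite subrK le_max.
by case/orP => // /le_lt_trans /(_ (h _ _ Nk Ni)); rewrite ltNge ek.
Qed.

Lemma Qp_piP (x : Qp) : exists u : cauchy_seq, x = \pi_Qp%qT u.
Proof. by exists (repr x); rewrite reprK. Qed.

Lemma Qp_pi_eq0 (u : cauchy_seq) :
  (\pi_Qp%qT u == 0 :> Qp) <-> padic_null p u.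
Proof.
have -> : (0 : Qp) = \pi_Qp%qT (0 : cauchy_seq) by rewrite rmorph0.
rewrite -Quotient.idealrBE subr0; split => [/asboolP//|h]; exact/asboolP.
Qed.

Lemma Qp_inv_ex (x : Qp) : x != 0 -> exists y : Qp, y * x = 1.
Proof.
have [u ->] := Qp_piP x => /negP /Qp_pi_eq0 nu.
have cu := cauchy_seqP u.
have [N [c c0 hc]] := padic_cauchy_nonnull cu nu.
have u0 i : (N <= i)%N -> u i != 0.
  by move=> Ni; rewrite -(rat_padic_abs_eq0 pr) hc // gt_eqF.
pose v i := (u i)^-1.
have cv : v \in cauchy_pred pr.
  apply/asboolP => e e0.
  have [M hM] := cu _ (mulr_gt0 e0 (mulr_gt0 c0 c0)).
  exists (maxn N M) => i j; rewrite !geq_max => /andP[Ni Mi] /andP[Nj Mj].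
  have -> : v i - v j = (u j - u i) * ((u i)^-1 * (u j)^-1).
    by rewrite /v; field; rewrite u0 // u0.
  rewrite !rat_padic_absM // !rat_padic_absV // !hc // -invfM.
  by rewrite ltr_pdivrMr ?mulr_gt0 // hM.
exists (\pi_Qp%qT (CauchySeq cv)); apply/eqP; rewrite -subr_eq0.
have -> : (1 : Qp) = \pi_Qp%qT (1 : cauchy_seq) by rewrite rmorph1.
rewrite -rmorphM -rmorphB; apply/Qp_pi_eq0 => e e0; exists N => i Ni.
have -> : cauchy_val (CauchySeq cv * u - 1) i = v i * u i - 1 by [].
by rewrite /v mulVf ?u0 // subrr rat_padic_abs0.
Qed.

Definition Qp_inv (x : Qp) : Qp :=
  if x == 0 then 0 else xget 0 [set y | y * x = 1].

Lemma Qp_mulVf (x : Qp) : x != 0 -> Qp_inv x * x = 1.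
Proof.
move=> x0; rewrite /Qp_inv (negbTE x0).
exact: (xgetPex 0 (Qp_inv_ex x0)).
Qed.

Lemma Qp_inv0 : Qp_inv 0 = 0. Proof. by rewrite /Qp_inv eqxx. Qed.

HB.instance Definition _ := GRing.ComNzRing_isField.Build Qp Qp_mulVf Qp_inv0.

(** ** The p-adic absolute value on [Qp] *)

(* The p-adic absolute value takes values in 0 and the powers of [p], so it is
   first defined with rational values; [Qp_abs] below is its real version. *)
Definition Qp_rat_abs (x : Qp) : rat :=
  xget 0 [set c | padic_abs_lim p (repr x) c].

Lemma padic_abs_lim_uniq u a b :
  padic_abs_lim p u a -> padic_abs_lim p u b -> a = b.
Proof.
move=> ha hb; apply/eqP; apply: contraT => ab.
have e0 : 0 < `|a - b| / 2 by rewrite divr_gt0 // normr_gt0 subr_eq0.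
have [N1 h1] := ha _ e0; have [N2 h2] := hb _ e0.
have := h1 _ (leq_maxl N1 N2); have := h2 _ (leq_maxr N1 N2).
set t := pabs _; move=> k1 k2.
have : `|a - b| <= `|a - t| + `|b - t| by rewrite (distrC b) ler_distD.
lra.
Qed.

Lemma padic_abs_lim_eq u v a : padic_null p (u - v) ->
  padic_abs_lim p u a -> padic_abs_lim p v a.
Proof.
move=> nuv ha e e0.
have e20 : 0 < e / 2 by rewrite divr_gt0.
have [N1 h1] := ha _ e20; have [N2 h2] := nuv _ e20.
exists (maxn N1 N2) => i; rewrite geq_max => /andP[/h1 k1 /h2].
rewrite -[(u - v) i]/(u i - v i) => k2.
have k3 := rat_padic_absD pr (u i - v i) (v i).
have k4 := rat_padic_absB pr (u i) (u i - v i).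
rewrite subrK in k3; rewrite opprB addrC subrK in k4.
have g1 := rat_padic_abs_ge0 pr (u i).
have g2 := rat_padic_abs_ge0 pr (v i).
have g3 := rat_padic_abs_ge0 pr (u i - v i).
move: k3 k4; rewrite !le_max => k3 k4.
move: k1; rewrite !ltr_norml => /andP[k1 k1']; apply/andP.
by case/orP: k3 => k3; case/orP: k4 => k4; split; lra.
Qed.

Lemma padic_abs_lim_null u : padic_null p u <-> padic_abs_lim p u 0.
Proof.
split=> h e /h[N hN]; exists N => i /hN.
  by rewrite sub0r normrN ger0_norm ?rat_padic_abs_ge0.
by rewrite sub0r normrN ger0_norm ?rat_padic_abs_ge0.
Qed.

Lemma padic_abs_lim_cst u c N : (forall i, (N <= i)%N -> pabs (u i) = c) ->
  padic_abs_lim p u c.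
Proof. by move=> h e e0; exists N => i /h ->; rewrite subrr normr0. Qed.

Lemma padic_abs_lim_ex u : padic_cauchy p u -> exists c, padic_abs_lim p u c.
Proof.
move=> cu; have [/padic_abs_lim_null nu|nu] := pselect (padic_null p u).
  by exists 0.
have [N [c _ h]] := padic_cauchy_nonnull cu nu.
by exists c; apply: padic_abs_lim_cst h.
Qed.

Lemma Qp_rat_abs_lim (u : cauchy_seq) :
  padic_abs_lim p u (Qp_rat_abs (\pi_Qp%qT u)).
Proof.
have := xgetPex 0 (padic_abs_lim_ex (cauchy_seqP (repr (\pi_Qp%qT u : Qp)))).
rewrite -/(Qp_rat_abs _) => h; apply: padic_abs_lim_eq h.
have /asboolP : repr (\pi_Qp%qT u : Qp) - u \in null_pred.
  by rewrite Quotient.idealrBE reprK.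
by [].
Qed.

Lemma Qp_rat_absP (u : cauchy_seq) c :
  padic_abs_lim p u c -> Qp_rat_abs (\pi_Qp%qT u) = c.
Proof. exact/padic_abs_lim_uniq/Qp_rat_abs_lim. Qed.

Lemma Qp_rat_abs_eq0 (x : Qp) : (Qp_rat_abs x == 0) = (x == 0).
Proof.
have [u ->] := Qp_piP x; apply/eqP/idP => [h|/Qp_pi_eq0/padic_abs_lim_null].
  by apply/Qp_pi_eq0/padic_abs_lim_null; rewrite -h; exact: Qp_rat_abs_lim.
exact: Qp_rat_absP.
Qed.

Lemma Qp_rat_abs0 : Qp_rat_abs 0 = 0.
Proof. by apply/eqP; rewrite Qp_rat_abs_eq0. Qed.

Lemma Qp_rat_abs_ge0 (x : Qp) : 0 <= Qp_rat_abs x.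
Proof.
have [u ->] := Qp_piP x; set c := Qp_rat_abs _.
rewrite leNgt; apply/negP => c0.
have c1 : 0 < - c by lra.
have [N /(_ _ (leqnn N))] := Qp_rat_abs_lim u c1.
rewrite -/c ltr_norml => /andP[+ _].
have := rat_padic_abs_ge0 pr (u N); lra.
Qed.

Lemma Qp_rat_absD (x y : Qp) :
  Qp_rat_abs (x + y) <= Num.max (Qp_rat_abs x) (Qp_rat_abs y).
Proof.
have [u ->] := Qp_piP x; have [v ->] := Qp_piP y; rewrite -rmorphD.
have := Qp_rat_abs_lim u; have := Qp_rat_abs_lim v.
have := Qp_rat_abs_lim (u + v).
set a := Qp_rat_abs _; set b := Qp_rat_abs _; set c := Qp_rat_abs _.
move=> ha hb hc; rewrite leNgt gt_max; apply/negP => /andP[ca ba].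
have e1 : 0 < (a - c) / 2 by lra.
have e2 : 0 < (a - b) / 2 by lra.
have e0 : 0 < Num.min ((a - c) / 2) ((a - b) / 2) by rewrite lt_min e1.
have [N1 h1] := ha _ e0; have [N2 h2] := hb _ e0; have [N3 h3] := hc _ e0.
pose i := maxn N1 (maxn N2 N3).
have /h1 : (N1 <= i)%N by rewrite leq_maxl.
have /h2 : (N2 <= i)%N by rewrite /i maxnCA leq_maxl.
have /h3 : (N3 <= i)%N by rewrite /i maxnA leq_maxr.
rewrite !lt_min !ltr_norml.
move=> /andP[/andP[? ?] /andP[? ?]] /andP[/andP[? ?] /andP[? ?]].
move=> /andP[/andP[? ?] /andP[? ?]].
have := rat_padic_absD pr (u i) (v i).
rewrite -[u i + v i]/((u + v) i) le_max => /orP[?|?]; lra.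
Qed.

Lemma Qp_rat_absM (x y : Qp) :
  Qp_rat_abs (x * y) = Qp_rat_abs x * Qp_rat_abs y.
Proof.
have [->|] := eqVneq x 0; first by rewrite mul0r Qp_rat_abs0 mul0r.
have [->|] := eqVneq y 0; first by rewrite mulr0 Qp_rat_abs0 mulr0.
have [u ->] := Qp_piP x; have [v ->] := Qp_piP y.
move=> /negP /Qp_pi_eq0 nv /negP /Qp_pi_eq0 nu.
have [N [a a0 ha]] := padic_cauchy_nonnull (cauchy_seqP u) nu.
have [M [b b0 hb]] := padic_cauchy_nonnull (cauchy_seqP v) nv.
rewrite (Qp_rat_absP (padic_abs_lim_cst ha)).
rewrite (Qp_rat_absP (padic_abs_lim_cst hb)) -rmorphM.
apply: Qp_rat_absP; apply: (@padic_abs_lim_cst _ _ (maxn N M)) => i.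
rewrite geq_max => /andP[/ha <- /hb <-].
by rewrite -[_ i]/(u i * v i) rat_padic_absM.
Qed.

Lemma cst_cauchy (r : rat) : (fun=> r) \in cauchy_pred pr.
Proof.
by apply/asboolP => e e0; exists 0%N => i j _ _; rewrite subrr rat_padic_abs0.
Qed.

Let cst_Qp (r : rat) : Qp := \pi_Qp%qT (CauchySeq (cst_cauchy r)).

Let cst_Qp_zmod_morphism : zmod_morphism cst_Qp.
Proof.
by move=> x y; rewrite /cst_Qp -rmorphB; congr (\pi_Qp%qT _); exact: val_inj.
Qed.

Let cst_Qp_monoid_morphism : monoid_morphism cst_Qp.
Proof.
split=> [|x y].
  rewrite /cst_Qp -[RHS](rmorph1 \pi_Qp%qT).
  by congr (\pi_Qp%qT _); exact: val_inj.
by rewrite /cst_Qp -rmorphM; congr (\pi_Qp%qT _); exact: val_inj.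
Qed.

HB.instance Definition _ :=
  GRing.isZmodMorphism.Build rat Qp cst_Qp cst_Qp_zmod_morphism.
HB.instance Definition _ :=
  GRing.isMonoidMorphism.Build rat Qp cst_Qp cst_Qp_monoid_morphism.

Lemma Qp_ratr (r : rat) : ratr r = \pi_Qp%qT (CauchySeq (cst_cauchy r)) :> Qp.
Proof. by rewrite -(fmorph_eq_rat cst_Qp). Qed.

Lemma Qp_rat_abs_ratr (r : rat) : Qp_rat_abs (ratr r) = rat_padic_abs p r.
Proof. by rewrite Qp_ratr; apply/Qp_rat_absP/(@padic_abs_lim_cst _ _ 0). Qed.

Lemma Qp_rat_abs1 : Qp_rat_abs 1 = 1.
Proof. by rewrite -(rmorph1 cst_Qp) fmorph_eq_rat Qp_rat_abs_ratr rat_padic_abs1. Qed.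

Lemma Qp_rat_absN (x : Qp) : Qp_rat_abs (- x) = Qp_rat_abs x.
Proof.
have N1 : Qp_rat_abs (-1) = 1.
  rewrite -(rmorphN1 cst_Qp) fmorph_eq_rat Qp_rat_abs_ratr.
  by rewrite rat_padic_absN // rat_padic_abs1.
by rewrite -mulN1r Qp_rat_absM N1 mul1r.
Qed.

Lemma Qp_rat_dense (x : Qp) (e : rat) : 0 < e ->
  exists r : rat, Qp_rat_abs (x - ratr r) < e.
Proof.
move=> e0; have [u ->] := Qp_piP x.
have e20 : 0 < e / 2 by lra.
have [N h] := cauchy_seqP u e20; exists (u N); rewrite Qp_ratr -rmorphB.
have [M /(_ _ (leq_maxl M N))] := Qp_rat_abs_lim (u - CauchySeq (cst_cauchy (u N))) e20.
set c := Qp_rat_abs _; rewrite -[_ (maxn M N)]/(u (maxn M N) - u N).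
by have := h _ _ (leq_maxr M N) (leqnn N); rewrite ltr_norml => ? /andP[? ?]; lra.
Qed.

Definition Qp_dist (x y : Qp) : rat := Qp_rat_abs (x - y).

Lemma Qp_distxx x : Qp_dist x x = 0.
Proof. by rewrite /Qp_dist subrr Qp_rat_abs0. Qed.

Lemma Qp_dist_eq0 x y : Qp_dist x y = 0 -> x = y.
Proof. by move/eqP; rewrite Qp_rat_abs_eq0 subr_eq0 => /eqP. Qed.

Lemma Qp_distC x y : Qp_dist x y = Qp_dist y x.
Proof. by rewrite /Qp_dist -Qp_rat_absN opprB. Qed.

Lemma Qp_dist_triangle y x z : Qp_dist x z <= Qp_dist x y + Qp_dist y z.
Proof.
rewrite /Qp_dist -(subrKA y); apply: le_trans (Qp_rat_absD _ _) _.
by rewrite ge_max lerDl lerDr !Qp_rat_abs_ge0.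
Qed.

HB.instance Definition _ := isPointed.Build Qp 0.
HB.instance Definition _ := isMetric.Build rat Qp
  Qp_distxx Qp_dist_eq0 Qp_distC Qp_dist_triangle.

End cauchy_sequences.

(** ** The space [Qp^n] with its norm and its Borel sigma-algebra *)

Definition Qpn (p : nat) (pr : prime p) (n : nat) : Type := 'rV[Qp pr]_n.

HB.instance Definition _ (p : nat) (pr : prime p) (n : nat) :=
  GRing.Zmodule.on (Qpn pr n).
HB.instance Definition _ (p : nat) (pr : prime p) (n : nat) :=
  PointedUniform.copy (Qpn pr n) 'rV[Qp pr]_n.
HB.instance Definition _ (p : nat) (pr : prime p) (n : nat) :=
  PseudoMetric.copy (Qpn pr n) 'rV[Qp pr]_n.
HB.instance Definition _ (p : nat) (pr : prime p) (n : nat) :=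
  Measurable.copy (Qpn pr n) (g_sigma_algebraType (@open (Qpn pr n))).

Section padic_analysis.
Variables (R : realType) (p : nat) (pr : prime p) (n : nat).

Local Notation V := (Qpn pr n).

Definition Qp_abs (x : Qp pr) : R := ratr (Qp_rat_abs x).

Definition Qpn_abs (x : V) : R := \big[Num.max/0]_(j < n) Qp_abs (x ord0 j).

Definition Qpn_ball (r : R) : set V := [set t | Qpn_abs t <= r].

Definition padic_ball (gamma : int) : set V := Qpn_ball (p%:R ^ gamma).

Variable mu : {measure set V -> \bar R}.

(* These two conditions determine [mu] on the Borel sets: they make it finite
   on bounded sets, hence Radon since [Qp^n] is second countable and locally
   compact. *)
Definition normalized_haar : Prop :=
  (forall (a : V) (A : set V), measurable A -> mu [set a + x | x in A] = mu A)
  /\ mu (Qpn_ball 1) = 1%E.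

Definition hardy (f : V -> R) (x : V) : R :=
  (Qpn_abs x ^+ n)^-1 * \int[mu]_(t in Qpn_ball (Qpn_abs x)) f t.

Definition hardy_dual (f : V -> R) (x : V) : R :=
  \int[mu]_(t in ~` Qpn_ball (Qpn_abs x)) (f t / Qpn_abs t ^+ n).

(* [hardy] and [hardy_dual] are total functions; these predicates say that the
   integrals defining them at [x] converge. *)
Definition hardy_defined (f : V -> R) (x : V) : Prop :=
  mu.-integrable (Qpn_ball (Qpn_abs x)) (fun t => (f t)%:E).

Definition hardy_dual_defined (f : V -> R) (x : V) : Prop :=
  mu.-integrable (~` Qpn_ball (Qpn_abs x)) (fun t => (f t / Qpn_abs t ^+ n)%:E).

Definition commutator (b : V -> R) (T : (V -> R) -> V -> R) (f : V -> R)
  (x : V) : R := b x * T f x - T (fun t => b t * f t) x.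

Definition commutator_defined (b : V -> R) (D : (V -> R) -> V -> Prop)
  (f : V -> R) (x : V) : Prop := D f x /\ D (fun t => b t * f t) x.

(* Functions are Borel measurable representatives of their a.e. classes. *)
Definition Lloc (s : R) (f : V -> R) : Prop :=
  measurable_fun setT f /\
  forall K : set V, compact K -> (\int[mu]_(x in K) (`|f x| `^ s)%:E < +oo)%E.

Definition ball_mean (f : V -> R) (gamma : int) : R :=
  (fine (mu (padic_ball gamma)))^-1 * \int[mu]_(x in padic_ball gamma) f x.

Definition CMO_norm (s : R) (f : V -> R) : \bar R :=
  ereal_sup [set (((fine (mu (padic_ball gamma)))^-1%:E *
     \int[mu]_(x in padic_ball gamma)
        (`|f x - ball_mean f gamma| `^ s)%:E) `^ s^-1)%E
    | gamma in [set: int]].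

Definition CMO (s : R) (f : V -> R) : Prop :=
  Lloc s f /\ (CMO_norm s f < +oo)%E.

Definition weighted_norm (q alpha : R) (f : V -> R) : \bar R :=
  ((\int[mu]_x (`|f x| `^ q * Qpn_abs x `^ alpha)%:E) `^ q^-1)%E.

Definition weighted_L (q alpha : R) (f : V -> R) : Prop :=
  measurable_fun setT f /\ (weighted_norm q alpha f < +oo)%E.

(* Boundedness on [L^q(|x|^alpha dx)] of the operator given by [T], where
   [D f x] says that [T f] is well defined at [x]. *)
Definition weighted_bounded (q alpha : R) (D : (V -> R) -> V -> Prop)
  (T : (V -> R) -> V -> R) : Prop :=
  exists C : R, forall f : V -> R, weighted_L q alpha f ->
    [/\ forall x : V, x != 0 -> D f x,
        weighted_L q alpha (T f) &
        (weighted_norm q alpha (T f) <= C%:E * weighted_norm q alpha f)%E].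

End padic_analysis.

(* Main.v *)
From HB Require Import structures.
Require Import Defs.
From mathcomp Require Import all_boot all_order all_algebra.
From mathcomp Require Import zify ring lra.
From mathcomp Require Import all_classical all_reals all_analysis.
From mathcomp Require Import measurable_realfun.

Import Order.TTheory GRing.Theory Num.Theory.
Local Open Scope classical_set_scope.
Local Open Scope ring_scope.

Set Implicit Arguments.
Unset Strict Implicit.
Unset Printing Implicit Defensive.

(** Let [phi x = 1 + |b x - m x|], where [m x] is the mean of [b] over the ball of
radius [|x|].  The means over consecutive balls differ by a bounded amount, so
for every [e > 0], [|b x - b t| <= C (max(|x|,|t|) / min(|x|,|t|))^e phi x phi t]:
both commutators are dominated by Hardy-type operators with kernels
[phi x |x|^a phi t |t|^c], [a + c = -n], supported in [|t| <= |x|], resp.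
[|x| <= |t|].  As [phi >= 1] and [phi^max(q,q')] has integral [O(p^(kn))] on the
shell [|x| = p^k], the integrals of [phi^r |x|^g] ([r = q, q']) over balls or
complements of balls are geometric series, and Schur's test (Hoelder with the
weight [|t|^sigma], then Tonelli) concludes; a suitable [sigma] exists exactly
when [alpha < nq/q'], resp. [alpha > -n]. *)

(** The means over balls of radii p^j and p^(j+m) drift apart linearly in m, that is,
    logarithmically in the ratio of the radii. The power e absorbs this drift at the cost of an
    arbitrarily small shift of exponents, for which the strict inequalities on alpha leave room. The
    summand 1 in phi serves twice: it bounds the sum of two oscillations and a drift by a product,
    hence by a kernel with separated variables, and it makes phi^r increasing in r, so that one CMO
    exponent serves both q and q'. The relation a + c = -n is what makes the two Schur conditions
    compatible: both are then governed by the single parameter sigma. Convergence of the integrals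
    defining the operators is not assumed; it comes from the Hoelder half of Schur's test, at every
    nonzero point. Translation invariance of [mu] enters only through the measures p^(kn) of balls.
    Since the norm takes countably many values, every function of the norm is measurable, so the
    averages over balls need no separate argument as functions of x. *)

Section padic_absolute_value.
Variables (R : realType) (p : nat) (pr : prime p).
Local Notation K := (Qp pr).
Local Notation pabs := (rat_padic_abs p).

(** * Values of the p-adic absolute value and residues modulo [p] *)

Lemma rat_padic_abs_int (m : int) : pabs m%:~R <= 1.
Proof.
rewrite /rat_padic_abs; case: ifPn => // m0.
rewrite intr_eq0 in m0.
have -> : m%:~R = m%:Q / 1%:Q by rewrite divr1.
rewrite padic_valE // logn1 subr0 -exprnN invf_le1 ?exprn_gt0 ?ltr0n ?prime_gt0 //.
by rewrite exprn_ege1 // ler1n prime_gt0.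
Qed.

Lemma rat_padic_abs_unit (m : int) : ~~ (p %| `|m|)%N -> pabs m%:~R = 1.
Proof.
move=> pm; have m0 : m != 0 by apply: contraNneq pm => ->; rewrite dvdn0.
rewrite /rat_padic_abs intr_eq0 (negbTE m0).
have -> : m%:~R = m%:Q / 1%:Q by rewrite divr1.
by rewrite padic_valE // logn1 subr0 lognE (negbTE pm) !andbF.
Qed.

Lemma rat_padic_abs_dvd (m : int) : (p %| `|m|)%N -> pabs m%:~R <= p%:Q^-1.
Proof.
move=> /dvdnP[k mk]; have {mk} [l ->] : exists l : int, m = l * p.
  have : (p %| m)%Z by rewrite dvdzE; apply/dvdnP; exists k.
  by move/dvdzP.
by rewrite intrM rat_padic_absM // rat_padic_abs_prime // ler_piMl ?rat_padic_abs_int //.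
Qed.

(** Let r = u/d in lowest terms. If [p] divided d, it would not divide u and |r| |d| would be 1,
    although |r| <= 1 and |d| <= 1/p. So d has an inverse s modulo [p] (Bezout), and the digit is u
    s modulo [p]. *)
Lemma rat_padic_residue (r : rat) : pabs r <= 1 ->
  exists a : 'I_p, pabs (r - a%:R) <= p%:Q^-1.
Proof.
move=> r1; have p0 := prime_gt0 pr.
have [u [d [pd er]]] : exists u d : int, ~~ (p %| `|d|)%N /\ r = u%:~R / d%:~R.
  exists (numq r), (denq r); split; last by rewrite divq_num_den.
  apply/negP => pd; have /negP pu : ~~ (p %| `|numq r|)%N.
    have := coprime_num_den r; rewrite coprime_sym => /(coprime_dvdl pd).
    by rewrite prime_coprime.
  have : pabs r * pabs (denq r)%:~R = 1.
    rewrite -rat_padic_absM // -{1}(divq_num_den r) divfK ?intr_eq0 ?denq_neq0 //.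
    by rewrite rat_padic_abs_unit //; exact/negP.
  move=> e; have := ler_pM (rat_padic_abs_ge0 pr _) (rat_padic_abs_ge0 pr _) r1
    (rat_padic_abs_dvd pd).
  rewrite e mul1r leNgt invf_lt1 ?ltr0n // ltr1n prime_gt1 //.
have d0 : d%:~R != 0 :> rat.
  by rewrite intr_eq0; apply: contraNneq pd => ->; rewrite dvdn0.
have [s [t st]] : exists s t : int, s * d + t * p = 1.
  have [s [t e]] := Bezoutz d p; exists s, t; rewrite e.
  apply/eqP; rewrite -[_ == _]/(coprimez d p) coprimezE coprime_sym.
  by rewrite prime_coprime.
pose a : int := modz (u * s) p.
have a0 : (0 <= a) by rewrite modz_ge0 // -lt0n.
have ap : (a < p) by rewrite ltz_pmod // ltz_nat.
have apn : (`|a|%N < p)%N by lia.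
exists (Ordinal apn) => /=.
have -> : `|a|%N%:R = a%:~R :> rat by rewrite -[in RHS](gez0_abs a0).
have -> : r - a%:~R = (u - a * d)%:~R / d%:~R.
  by rewrite er intrB intrM; field.
rewrite rat_padic_absM // rat_padic_absV // (rat_padic_abs_unit pd) invr1 mulr1.
apply: rat_padic_abs_dvd; rewrite -[X in (X %| _)%N]/(`|p%:Z|%N) -dvdzE.
have eu : u * s = (u * s %/ p)%Z * p + a by exact: divz_eq.
clearbody a; move: eu; set Q := (_ %/ _)%Z => eu.
apply/dvdzP; exists (u * t + Q * d).
have -> : u - a * d = u * (s * d + t * p) - a * d by rewrite st mulr1.
have -> : a = u * s - Q * p by rewrite eu addrC addKr.
ring.
Qed.

Lemma Qp_abs_ge0 (x : K) : 0 <= Qp_abs R x.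
Proof. by rewrite ler0q Qp_rat_abs_ge0. Qed.

Lemma Qp_abs_eq0 (x : K) : (Qp_abs R x == 0) = (x == 0).
Proof. by rewrite fmorph_eq0 Qp_rat_abs_eq0. Qed.

Lemma Qp_absM (x y : K) : Qp_abs R (x * y) = Qp_abs R x * Qp_abs R y.
Proof. by rewrite /Qp_abs Qp_rat_absM rmorphM. Qed.

Lemma Qp_absN (x : K) : Qp_abs R (- x) = Qp_abs R x.
Proof. by rewrite /Qp_abs Qp_rat_absN. Qed.

Lemma Qp_abs1 : Qp_abs R (1 : K) = 1.
Proof. by rewrite /Qp_abs Qp_rat_abs1 rmorph1. Qed.

Lemma Qp_absD_le (x y : K) (r : R) :
  Qp_abs R x <= r -> Qp_abs R y <= r -> Qp_abs R (x + y) <= r.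
Proof.
move=> xr yr; have := Qp_rat_absD x y; rewrite le_max -!(ler_rat R).
by case/orP => /le_trans; apply.
Qed.

Lemma Qp_abs_ratr (r : rat) : Qp_abs R (ratr r : K) = ratr (pabs r).
Proof. by rewrite /Qp_abs Qp_rat_abs_ratr. Qed.

(** Along a Cauchy sequence that is not null the absolute values are eventually constant, so the
    limit is already the absolute value of a nonzero rational. *)
Lemma Qp_abs_value (x : K) : x != 0 -> exists k : int, Qp_abs R x = p%:R ^ k.
Proof.
have [u ->] := Qp_piP x => /negP /Qp_pi_eq0 nu.
have [N [c c0 hc]] := padic_cauchy_nonnull pr (cauchy_seqP u) nu.
rewrite /Qp_abs (Qp_rat_absP (padic_abs_lim_cst hc)).
have := hc _ (leqnn N); rewrite /rat_padic_abs; case: ifPn => [_ e|_ <-].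
  by rewrite -e ltxx in c0.
exists (- padic_val p (cauchy_val u N)).
by rewrite rmorphXz ?rmorph_nat // unitfE pnatr_eq0 -lt0n prime_gt0.
Qed.

Lemma Qp_abs_scale (k : int) : exists2 c : K, c != 0 & Qp_abs R c = p%:R ^ k.
Proof.
have p0 : p%:R != 0 :> R by rewrite pnatr_eq0 -lt0n prime_gt0.
have ep : Qp_abs R (ratr p%:Q : K) = p%:R^-1.
  by rewrite Qp_abs_ratr rat_padic_abs_prime // fmorphV /= ratr_int.
have absX (x : K) m : Qp_abs R (x ^+ m) = Qp_abs R x ^+ m.
  by elim: m => [|m IH]; rewrite ?expr0 ?Qp_abs1 // !exprS Qp_absM IH.
have pK : (ratr p%:Q : K) != 0 by rewrite -Qp_abs_eq0 ep invr_eq0.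
case: k => m.
  exists ((ratr p%:Q)^-1 ^+ m); first by rewrite expf_neq0 // invr_eq0.
  rewrite absX; congr (_ ^+ _).
  have : Qp_abs R ((ratr p%:Q : K)^-1) * p%:R^-1 = 1.
    by rewrite -ep -Qp_absM mulVf // Qp_abs1.
  by move/(canRL (mulfVK p0)) ; rewrite mul1r.
exists ((ratr p%:Q) ^+ m.+1); first by rewrite expf_neq0.
by rewrite absX ep NegzE -exprnN exprVn.
Qed.

(** A rational at distance less than 1/p from [x] is again of absolute value at most 1, and its
    digit works for [x]. *)
Lemma Qp_residue (x : K) : Qp_abs R x <= 1 ->
  exists a : 'I_p, Qp_abs R (x - a%:R) <= p%:R^-1.
Proof.
move=> x1; have pV : 0 < p%:Q^-1 by rewrite invr_gt0 ltr0n prime_gt0.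
have [r hr] := Qp_rat_dense x pV.
have pV1 : p%:Q^-1 <= 1 by rewrite invf_le1 ?ler1n ?ltr0n prime_gt0.
have r1 : pabs r <= 1.
  rewrite -(ler_rat R) -Qp_abs_ratr rmorph1 -(subrK x (ratr r)).
  apply: Qp_absD_le => //; rewrite -Qp_absN opprB -(rmorph1 (@ratr R)) ler_rat.
  exact: le_trans (ltW hr) _.
have [a ha] := rat_padic_residue r1; exists a.
have epV : p%:R^-1 = ratr p%:Q^-1 :> R by rewrite fmorphV /= ratr_int.
rewrite -(subrKA (ratr r)) epV; apply: Qp_absD_le.
  by rewrite ler_rat ltW.
have absZ (z : int) : Qp_abs R (z%:~R : K) = ratr (pabs z%:~R).
  by rewrite -Qp_abs_ratr ratr_int.
have d0 : (denq r)%:~R != 0 :> rat by rewrite intr_eq0 denq_neq0.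
have dK : (denq r)%:~R != 0 :> K.
  by rewrite -Qp_abs_eq0 absZ fmorph_eq0 rat_padic_abs_eq0.
(* Multiplying by the denominator of [r] leaves only images of integers, which [absZ] evaluates. *)
rewrite -(ler_pM2r (_ : 0 < Qp_abs R ((denq r)%:~R : K))); last first.
  by rewrite lt_neqAle Qp_abs_ge0 eq_sym Qp_abs_eq0 dK.
rewrite -Qp_absM mulrBl divfK //.
have -> : (numq r)%:~R - a%:R * (denq r)%:~R = (numq r - a%:Z * denq r)%:~R :> K.
  by rewrite intrB intrM.
rewrite !absZ -rmorphM ler_rat /= intrB intrM.
have -> : (numq r)%:~R = r * (denq r)%:~R.
  by rewrite -{2}(divq_num_den r) divfK.
by rewrite -mulrBl rat_padic_absM // ler_wpM2r ?rat_padic_abs_ge0.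
Qed.

(** Distinct digits differ by an integer prime to [p], of absolute value 1 > 1/p. This makes the
    translates that tile a ball disjoint. *)
Lemma Qp_residue_inj (a a' : 'I_p) :
  Qp_abs R (a%:R - a'%:R : K) <= p%:R^-1 -> a = a'.
Proof.
move=> h; apply/eqP; apply: contraT => aa'; move: h; apply: contraLR => _.
have -> : (a%:R - a'%:R : K) = ratr (a%:Z - a'%:Z)%:~R.
  by rewrite ratr_int intrB.
rewrite Qp_abs_ratr rat_padic_abs_unit.
  by rewrite rmorph1 -ltNge invf_lt1 ?ltr0n ?prime_gt0 // ltr1n prime_gt1.
apply/negP => /dvdn_leq; move: (ltn_ord a) (ltn_ord a') aa'.
rewrite -(inj_eq val_inj) /=; lia.
Qed.

End padic_absolute_value.

(** * The ultrametric norm on [Qpn] and its balls *)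

Section padic_space.
Variables (R : realType) (p : nat) (pr : prime p) (n : nat).
Local Notation K := (Qp pr).
Local Notation V := (Qpn pr n).
Local Notation vabs := (@Qpn_abs R p pr n).

Lemma Qpn_abs_le (x : V) (r : R) : 0 <= r ->
  vabs x <= r <-> forall j, Qp_abs R (x ord0 j) <= r.
Proof.
move=> r0; split=> [/bigmax_leP[_ h] j|h]; first exact: h.
by apply/bigmax_leP; split.
Qed.

Lemma Qpn_abs_ge0 (x : V) : 0 <= vabs x.
Proof. exact: bigmax_ge_id. Qed.

Lemma Qpn_absN (x : V) : vabs (- x) = vabs x.
Proof. by apply: eq_bigr => j _; rewrite mxE Qp_absN. Qed.

Lemma Qpn_absD_le (x y : V) (r : R) :
  vabs x <= r -> vabs y <= r -> vabs (x + y) <= r.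
Proof.
move=> xr yr; have r0 := le_trans (Qpn_abs_ge0 x) xr.
apply/Qpn_abs_le => // j; rewrite mxE.
by apply: Qp_absD_le; [move/Qpn_abs_le : xr|move/Qpn_abs_le : yr]; apply.
Qed.

Lemma Qpn_dist_le (y x z : V) (r : R) :
  vabs (x - y) <= r -> vabs (y - z) <= r -> vabs (x - z) <= r.
Proof.
move=> xy yz; have -> : x - z = (x - y) + (y - z) by rewrite addrA subrK.
exact: Qpn_absD_le.
Qed.

Lemma Qpn_abs_eq0 (x : V) : (vabs x == 0) = (x == 0).
Proof.
apply/eqP/eqP => [x0|->]; last first.
  apply/le_anti; rewrite Qpn_abs_ge0 andbT; apply/Qpn_abs_le => // j.
  by rewrite mxE le_eqVlt Qp_abs_eq0 eqxx.
apply/rowP => j; rewrite mxE; apply/eqP.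
rewrite -(Qp_abs_eq0 R) eq_le Qp_abs_ge0 andbT.
by move: j; apply/Qpn_abs_le => //; rewrite x0.
Qed.

Lemma Qpn_abs0 : vabs 0 = 0.
Proof. by apply/eqP; rewrite Qpn_abs_eq0. Qed.

Lemma Qpn_abs_gt0 (x : V) : (0 < vabs x) = (x != 0).
Proof. by rewrite lt_neqAle Qpn_abs_ge0 andbT eq_sym Qpn_abs_eq0. Qed.

Lemma Qpn_abs_value (x : V) : x != 0 -> exists k : int, vabs x = p%:R ^ k.
Proof.
rewrite -Qpn_abs_eq0.
have : vabs x = 0 \/ exists k : int, vabs x = p%:R ^ k.
  rewrite /vabs; elim/big_ind: _ => [|r s hr hs|j _]; first by left.
    by rewrite maxEle; case: ifP.
  have [->|/(Qp_abs_value R)] := eqVneq (x ord0 j) 0; last by right.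
  by left; apply/eqP; rewrite Qp_abs_eq0.
by case=> [->|//]; rewrite eqxx.
Qed.

(** By the ultrametric inequality any point of a ball has a neighbourhood inside it; this is the
    link between the norm and the Borel sets. *)
Lemma Qpn_closed_ball_open (a : V) (r : R) : 0 < r ->
  open [set x : V | vabs (x - a) <= r].
Proof.
move=> r0; rewrite openE => x /= xr; apply/nbhs_ballP.
(* The metric of [Qp] takes rational values, so the real radius is replaced by a smaller rational
   one. *)
have [e e0 er] : exists2 e : rat, 0 < e & ratr e <= r.
  have [e] := rat_in_itvoo r0; rewrite in_itv /= => /andP[e0 er].
  by exists e; [rewrite -(ltr0q R)|exact: ltW].
exists e; first exact: e0.
move=> y xy.
apply: (Qpn_dist_le (y := x)); last exact: xr.
apply/Qpn_abs_le; first exact: ltW.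
move=> j.
apply: le_trans er.
rewrite -Qp_absN.
rewrite ler_rat ltW //.
have h : forall i j, Qp_dist (x i j) (y i j) < e := xy.2.
have := h ord0 j.
rewrite /Qp_dist => h'; rewrite !mxE opprB.
exact: h'.
Qed.

End padic_space.

(** * Measurability of radial functions and the Haar measure of balls *)

Section haar_measure.
Variables (R : realType) (p : nat) (pr : prime p) (n : nat).
Local Notation K := (Qp pr).
Local Notation V := (Qpn pr n).
Local Notation vabs := (@Qpn_abs R p pr n).
Local Notation ball := (@padic_ball R p pr n).
Variable mu : {measure set V -> \bar R}.

Let p_gt0 : 0 < p%:R :> R. Proof. by rewrite ltr0n prime_gt0. Qed.
Let p_neq0 : p%:R != 0 :> R. Proof. exact: lt0r_neq0. Qed.
Let p_gt1 : 1 < p%:R :> R. Proof. by rewrite ltr1n prime_gt1. Qed.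

Lemma measurable_closed_ball (a : V) (r : R) : 0 < r ->
  measurable [set x : V | vabs (x - a) <= r].
Proof. by move=> r0; apply: sub_sigma_algebra; exact: Qpn_closed_ball_open. Qed.

Lemma measurable_padic_ball (k : int) : measurable (ball k).
Proof.
have := @measurable_closed_ball 0 (p%:R ^ k) (exprz_gt0 k p_gt0).
suff -> : [set x : V | vabs (x - 0) <= p%:R ^ k] = ball k by [].
by apply/seteqP; split => x; rewrite /padic_ball /Qpn_ball /= subr0.
Qed.

Definition padic_shell (k : int) : set V := [set x | vabs x = p%:R ^ k].

Lemma padic_shellE (k : int) : padic_shell k = ball k `\` ball (k - 1).
Proof.
have lt1 : p%:R ^ (k - 1) < p%:R ^ k :> R by rewrite ltr_eXz2l // ltrBlDr ltrDl.
apply/seteqP; split => x; rewrite /padic_shell /padic_ball /Qpn_ball /=.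
  by move=> ->; split => //; apply/negP; rewrite -ltNge.
move=> [xk /negP]; rewrite -ltNge => kx.
have x0 : x != 0 by rewrite -(Qpn_abs_gt0 R) (lt_trans _ kx) // exprz_gt0.
have [j xj] := Qpn_abs_value R x0; rewrite xj; congr (_ ^ _).
move: xk kx; rewrite xj ler_eXz2l // ltr_eXz2l //; lia.
Qed.

Lemma measurable_padic_shell (k : int) : measurable (padic_shell k).
Proof. by rewrite padic_shellE; apply: measurableD; exact: measurable_padic_ball. Qed.

Lemma shells_cover : [set x : V | x != 0] = \bigcup_(k : int) padic_shell k.
Proof.
apply/seteqP; split => [x /(Qpn_abs_value R)[k xk]|x [k _ xk] /=]; first by exists k.
by rewrite -(Qpn_abs_gt0 R) xk exprz_gt0.
Qed.

Lemma measurable_nonzero : measurable [set x : V | x != 0].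
Proof.
rewrite shells_cover; apply: countable_bigcupT_measurable => //.
exact: measurable_padic_shell.
Qed.

Lemma measurable_point0 : measurable [set 0 : V].
Proof.
have -> : [set 0 : V] = ~` [set x : V | x != 0].
  by apply/seteqP; split=> x /=; [move=> ->; rewrite eqxx|move/negP; rewrite negbK => /eqP].
by apply: measurableC; exact: measurable_nonzero.
Qed.

(** The norm takes only the values 0 and p^k, so any preimage is a countable union of shells,
    possibly with the origin. As [G] is arbitrary, this also covers means and integrals over the
    ball of radius |x|. *)
Lemma measurable_radial d (T : measurableType d) (G : R -> T) :
  measurable_fun setT (fun x : V => G (vabs x)).
Proof.
move=> _ Y mY; rewrite setTI.
have -> : (fun x : V => G (vabs x)) @^-1` Y =
    (if `[< Y (G 0) >] then ~` [set x : V | x != 0] else set0) `|`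
    \bigcup_(k : int) (if `[< Y (G (p%:R ^ k)) >] then padic_shell k else set0).
  apply/seteqP; split => x /=.
    have [->|x0] := eqVneq x 0.
      by rewrite Qpn_abs0 => Y0; left; rewrite asboolT //= eqxx.
    have [k xk] := Qpn_abs_value R x0; rewrite xk => Yk; right; exists k => //.
    by rewrite asboolT.
  case=> [|[k _]]; case: asboolP => //= Yk.
    by move/negP; rewrite negbK -(Qpn_abs_eq0 R) => /eqP ->.
  by move=> ->.
apply: measurableU.
  by case: ifP => // _; apply: measurableC; exact: measurable_nonzero.
apply: countable_bigcupT_measurable => // k.
by case: ifP => // _; exact: measurable_padic_shell.
Qed.

Lemma measurable_Qpn_abs : measurable_fun setT vabs.
Proof. exact: (measurable_radial (@id R)). Qed.

Hypothesis haar : normalized_haar mu.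

(* [ball (k + 1)] is the disjoint union of the translates of [ball k] by [c * v],
   for [|c| = p^(k+1)] and [v] a vector of digits. *)
Lemma haar_ball_succ (k : int) : mu (ball (k + 1)) = ((p%:R ^+ n)%:E * mu (ball k))%E.
Proof.
have [c c0 ck] := Qp_abs_scale R pr (k + 1).
have pk : p%:R ^ k = p%:R ^ (k + 1) * p%:R^-1 :> R by rewrite expfzDr // expr1z mulfK.
pose a (v : {ffun 'I_n -> 'I_p}) : V := \row_j (c * (v j)%:R).
pose T v := [set a v + x | x in ball k].
have TE v : T v = [set x | vabs (x - a v) <= p%:R ^ k].
  apply/seteqP; split => [_ [x xk <-]|x xk] /=; first by rewrite addrC addKr.
  by exists (x - a v) => //; rewrite addrC subrK.
have mT v : measurable (T v) by rewrite TE; apply: measurable_closed_ball; exact: exprz_gt0.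
have cover : ball (k + 1) = \bigcup_v T v.
  apply/seteqP; split => x.
    move=> /Qpn_abs_le xk; have {xk} xk j : Qp_abs R (x ord0 j) <= p%:R ^ (k + 1).
      by apply: xk; rewrite exprz_ge0 // ltW.
    have /choice[v hv] : forall j, exists b : 'I_p,
        Qp_abs R (c^-1 * x ord0 j - b%:R) <= p%:R^-1.
      move=> j; apply: Qp_residue.
      rewrite -(ler_pM2l (exprz_gt0 (k + 1) p_gt0)) -{1}ck -Qp_absM mulr1.
      by rewrite mulrA mulfV // mul1r.
    exists [ffun j => v j] => //; rewrite TE /=; apply/Qpn_abs_le.
      by rewrite exprz_ge0 // ltW.
    move=> j; rewrite !mxE ffunE pk -ck.
    have -> : x ord0 j - c * (v j)%:R = c * (c^-1 * x ord0 j - (v j)%:R).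
      by rewrite mulrBr mulrA mulfV // mul1r.
    by rewrite Qp_absM ler_wpM2l ?Qp_abs_ge0.
  move=> [v _]; rewrite TE /= => xv; rewrite /padic_ball /Qpn_ball /= -(subrK (a v) x).
  apply: Qpn_absD_le.
    apply: le_trans xv _; rewrite pk ler_piMr ?exprz_ge0 ?(ltW p_gt0) //.
    by rewrite invf_le1 // ltW.
  apply/Qpn_abs_le; first by rewrite exprz_ge0 // ltW.
  move=> j; rewrite mxE Qp_absM ck ler_piMr ?exprz_ge0 ?(ltW p_gt0) //.
  rewrite -[(v j)%:R]/(((v j : nat) : int)%:~R) -ratr_int Qp_abs_ratr.
  by rewrite -(rmorph1 (@ratr R)) ler_rat rat_padic_abs_int.
have triv : trivIset setT T.
  apply/trivIsetP => v w _ _; apply: contra_neqP => /eqP/set0P[x []].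
  rewrite !TE /= => xv xw; apply/ffunP => j; apply: (@Qp_residue_inj R _ pr).
  rewrite -(ler_pM2l (exprz_gt0 (k + 1) p_gt0)) -pk -ck -Qp_absM mulrBr.
  have : vabs (a v - a w) <= p%:R ^ k.
    apply: (@Qpn_dist_le _ _ _ _ x); last exact: xw.
    by rewrite -Qpn_absN opprB; exact: xv.
  move=> /Qpn_abs_le /(_ j); rewrite !mxE; apply.
  by rewrite exprz_ge0 // ltW.
rewrite cover measure_fin_bigcup //.
have -> : [set: {ffun 'I_n -> 'I_p}] = [set` enum {ffun 'I_n -> 'I_p}].
  by apply/seteqP; split => v //= _; rewrite mem_enum.
rewrite -fsbig_seq ?enum_uniq //.
rewrite (eq_bigr (fun=> mu (ball k))); last first.
  by move=> v _; exact: (haar.1 _ _ (measurable_padic_ball k)).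
rewrite big_const_seq count_predT -cardE card_ffun !card_ord.
rewrite -natrX; elim: (_ ^ _)%N => [|m IH]; first by rewrite mul0e.
  by rewrite iterS IH -natr1 EFinD ge0_muleDl ?lee_fin // mul1e addeC.
exact: finite_finset.
Qed.

Lemma haar_ball (k : int) : mu (ball k) = ((p%:R ^ k) ^+ n)%:E.
Proof.
have b0 : mu (ball 0) = 1%E by rewrite /padic_ball expr0z haar.2.
elim: k => [|k IH|k IH]; first by rewrite b0 expr0z expr1n.
  rewrite -addn1 PoszD haar_ball_succ IH -EFinM; congr (_%:E).
  by rewrite expfzDr // expr1z exprMn mulrC.
have := haar_ball_succ (- k.+1%:Z).
have -> : - k.+1%:Z + 1 = - k%:Z by lia.
rewrite IH => e; have pn0 : p%:R ^+ n != 0 :> R by rewrite expf_neq0.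
have -> : mu (ball (- k.+1%:Z)) =
    (((p%:R ^+ n)^-1)%:E * ((p%:R ^+ n)%:E * mu (ball (- k.+1%:Z))))%E.
  by rewrite muleA -EFinM mulVf // mul1e.
rewrite -e -EFinM; congr (_%:E).
have -> : - k%:Z = - k.+1%:Z + 1 by lia.
by rewrite expfzDr // expr1z exprMn mulrC mulfK.
Qed.

(** The origin lies in balls of measure p^(-kn), which tends to 0 because [n] is positive. It lets
    integrals avoid the origin, where powers of the norm take default values. *)
Lemma haar_point0 : (0 < n)%N -> mu [set 0] = 0%E.
Proof.
move=> n0; have m0 := measurable_point0.
apply/eqP; rewrite eq_le measure_ge0 andbT; apply/lee_addgt0Pr => e e0; rewrite add0e.
have [k ke] : exists k : nat, (p%:R^-1) ^+ k < e.
  have : (fun k => (p%:R^-1 : R) ^+ k) @ \oo --> 0.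
    by apply: cvg_expr; rewrite ger0_norm ?invr_ge0 ?ler0n // invf_lt1.
  move/cvgrPdist_lt => /(_ _ e0)[k _ /(_ k (leqnn k))].
  rewrite sub0r normrN ger0_norm ?exprn_ge0 ?invr_ge0 ?ler0n // => ke.
  by exists k.
apply: (@le_trans _ _ (mu (ball (- k%:Z)))).
  apply: le_measure; rewrite ?inE //; first exact: measurable_padic_ball.
  move=> x ->; rewrite /padic_ball /Qpn_ball /=.
  by rewrite Qpn_abs0; exact/ltW/exprz_gt0.
rewrite haar_ball lee_fin -exprnN -exprVn -exprM mulnC exprM.
apply: le_trans (ltW ke).
apply: lerXn2r; rewrite ?nnegrE ?exprn_ge0 ?invr_ge0 ?ler0n //.
have pV1 : p%:R^-1 <= 1 :> R by rewrite invf_le1 ?ltW.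
by rewrite -[leRHS]expr1 ler_wiXn2l ?invr_ge0 ?ler0n.
Qed.

Lemma haar_sigma_finite : sigma_finite setT mu.
Proof.
exists (fun k : nat => ball k%:Z).
  apply/seteqP; split => x // _.
  have [->|/(Qpn_abs_value R)[k xk]] := eqVneq x 0.
    by exists 0%N => //; rewrite /padic_ball /Qpn_ball /= Qpn_abs0.
  by exists `|k|%N => //; rewrite /padic_ball /Qpn_ball /= xk ler_eXz2l // lez_abs.
move=> k; split; first exact: measurable_padic_ball.
by rewrite haar_ball ltry.
Qed.

End haar_measure.

Lemma le_integral_EFin d (T : measurableType d) (R : realType)
    (mu : {measure set T -> \bar R}) (D : set T) (f g : T -> R) :
  measurable D -> measurable_fun D f -> measurable_fun D g ->
  (forall x, D x -> 0 <= f x) -> (forall x, D x -> f x <= g x) ->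
  (\int[mu]_(x in D) (f x)%:E <= \int[mu]_(x in D) (g x)%:E)%E.
Proof.
move=> mD mf mg f0 fg; apply: ge0_le_integral => //.
- exact/measurable_EFinP.
- exact/measurable_EFinP.
Qed.

(** The product expands into the left side plus nonnegative terms. It turns the triangle inequality
    through two means into a bound that separates the variables. *)
Lemma three_terms_le (R : realType) (x y z : R) : 0 <= x -> 0 <= y -> 0 <= z ->
  x + z + y <= (1 + z) * ((1 + x) * (1 + y)).
Proof.
move=> x0 y0 z0; have xy0 : 0 <= x * y by rewrite mulr_ge0.
have zx0 : 0 <= z * x by rewrite mulr_ge0.
have zy0 : 0 <= z * y by rewrite mulr_ge0.
have zxy0 : 0 <= z * (x * y) by rewrite mulr_ge0.
lra.
Qed.

(** * Oscillation of a CMO function on shells and between two points *)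

Section mean_oscillation.
Variables (R : realType) (p : nat) (pr : prime p) (n : nat).
Local Notation V := (Qpn pr n).
Local Notation vabs := (@Qpn_abs R p pr n).
Local Notation ball := (@padic_ball R p pr n).
Local Notation shell := (@padic_shell R p pr n).
Variable mu : {measure set V -> \bar R}.
Hypothesis haar : normalized_haar mu.

Let p_gt0 : 0 < p%:R :> R. Proof. by rewrite ltr0n prime_gt0. Qed.
Let p_neq0 : p%:R != 0 :> R. Proof. exact: lt0r_neq0. Qed.
Let p_gt1 : 1 < p%:R :> R. Proof. by rewrite ltr1n prime_gt1. Qed.
Let pXn_gt0 (k : int) : 0 < (p%:R ^ k) ^+ n :> R.
Proof. by rewrite exprn_gt0 // exprz_gt0. Qed.

(** Indexed by a real radius instead of an exponent, so that its composition with the norm falls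
    under [measurable_radial]. *)
Definition radial_mean (b : V -> R) (r : R) : R :=
  (fine (mu (Qpn_ball r)))^-1 * \int[mu]_(x in Qpn_ball r) b x.

Lemma radial_meanE b k : radial_mean b (p%:R ^ k) = ball_mean mu b k.
Proof. reflexivity. Qed.

Definition oscillation (b : V -> R) (x : V) : R :=
  1 + `|b x - radial_mean b (vabs x)|.

Lemma oscillation_ge1 b x : 1 <= oscillation b x.
Proof. by rewrite lerDl. Qed.

Lemma oscillation_ge0 b x : 0 <= oscillation b x.
Proof. exact: le_trans (oscillation_ge1 _ _). Qed.

Lemma measurable_oscillation b :
  measurable_fun setT b -> measurable_fun setT (oscillation b).
Proof.
move=> mb; apply: measurable_funD => //; apply: measurableT_comp => //.
by apply: measurable_funB => //; exact: measurable_radial.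
Qed.

(** Since 1 + y <= 2 max(1, y). *)
Lemma powR_1D_le (s y : R) : 0 <= s -> 0 <= y ->
  (1 + y) `^ s <= 2 `^ s * (1 + y `^ s).
Proof.
move=> s0 y0; have [y1|y1] := leP y 1.
  apply: (@le_trans _ _ (2 `^ s)).
    by apply: ge0_ler_powR => //; rewrite ?nnegrE; lra.
  by rewrite ler_peMr ?powR_ge0 // lerDl powR_ge0.
apply: (@le_trans _ _ ((2 * y) `^ s)).
  by apply: ge0_ler_powR => //; rewrite ?nnegrE; lra.
by rewrite powRM // ler_wpM2l ?powR_ge0 // lerDr.
Qed.

Section cmo.
Variables (s : R) (b : V -> R).
Hypotheses (s_ge1 : 1 <= s) (b_CMO : CMO mu s b).

Let mb : measurable_fun setT b. Proof. exact: b_CMO.1.1. Qed.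
Let s_gt0 : 0 < s. Proof. exact: lt_le_trans s_ge1. Qed.

Let mdist (D : set V) c : measurable_fun D (fun x => `|b x - c|).
Proof.
by apply: measurable_funTS; apply: measurableT_comp => //; exact: measurable_funB.
Qed.

Let mdist_powR (D : set V) c : measurable_fun D (fun x => (1 + `|b x - c|) `^ s).
Proof.
apply: (measurableT_comp (measurable_powR _)).
by apply: measurable_funD => //; exact: mdist.
Qed.

Let dist_le_powR c x : `|b x - c| <= (1 + `|b x - c|) `^ s.
Proof.
have h1 : 1 <= 1 + `|b x - c| by rewrite lerDl.
apply: le_trans (_ : 1 + `|b x - c| <= _); first by rewrite lerDr.
by rewrite -[leLHS]powRr1 ?(le_trans ler01) // ler_powR.
Qed.

(** With N the CMO norm, the [s]-th power of the deviation has average at most N^s; [powR_1D_le]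
    inserts the summand 1, which gives M = 2^s (1 + N^s). *)
Lemma CMO_ball_bound : exists2 M : R, 0 <= M & forall k,
  (\int[mu]_(x in ball k) ((1 + `|b x - ball_mean mu b k|) `^ s)%:E
     <= (M * (p%:R ^ k) ^+ n)%:E)%E.
Proof.
have [_] := b_CMO.
set N := CMO_norm _ _ _ => N_fin.
have N_ge k : ((fine (mu (ball k)))^-1%:E *
     \int[mu]_(x in ball k) (`|b x - ball_mean mu b k| `^ s)%:E <= N `^ s)%E.
  set X := (X in (X <= _)%E).
  have X0 : (0 <= X)%E.
    apply: mule_ge0; first by rewrite lee_fin invr_ge0 fine_ge0.
    by apply: integral_ge0 => x _; rewrite lee_fin powR_ge0.
  have XN : (X `^ s^-1 <= N)%E by apply: ereal_sup_ubound; exists k.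
  (* The norm is a supremum of [s]-th roots, so the bound is applied to the root and then raised to
     the power [s]. *)
  have -> : X = ((X `^ s^-1) `^ s)%E.
    by rewrite -poweRrM mulVf ?lt0r_neq0 // poweRe1.
  apply: gt0_ler_poweR => //; rewrite ?ltW //.
    by rewrite in_itv /= poweR_ge0 leey.
  by rewrite in_itv /= leey andbT (le_trans _ XN) // poweR_ge0.
have Ns : (N `^ s)%E \is a fin_num.
  by rewrite ge0_fin_numE ?poweR_ge0 // poweR_lty.
exists (2 `^ s * (1 + fine (N `^ s)%E)).
  by rewrite mulr_ge0 ?powR_ge0 // addr_ge0 // fine_ge0 // poweR_ge0.
move=> k.
have mB := @measurable_padic_ball R p pr n k.
have mosc : measurable_fun (ball k) (fun x => `|b x - ball_mean mu b k| `^ s).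
  by apply: (measurableT_comp (measurable_powR _)); exact: mdist.
apply: (@le_trans _ _ (\int[mu]_(x in ball k)
    ((2 `^ s)%:E * (1 + `|b x - ball_mean mu b k| `^ s)%:E))%E).
  apply: le_integral_EFin => //.
  - by apply: measurable_funM => //; exact: measurable_funD.
  - by move=> x _; rewrite powR_1D_le // ltW.
rewrite ge0_integralZl_EFin ?powR_ge0 //; last first.
  by apply/measurable_EFinP; exact: measurable_funD.
under eq_integral do rewrite EFinD.
rewrite -mulrA EFinM lee_pmul2l ?lte_fin ?powR_gt0 // mulrDl mul1r EFinD.
rewrite ge0_integralD //; last exact/measurable_EFinP.
rewrite integral_cst // mul1e haar_ball // leeD2l //.
have := N_ge k; rewrite haar_ball // /=.
by rewrite lee_pdivrMl // -(fineK Ns) EFinM muleC.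
Qed.

Let icst c k : mu.-integrable (ball k) (EFin \o cst c).
Proof.
apply/integrableP; split; first exact/measurable_EFinP.
rewrite (eq_integral (cst `|c|%:E)) // integral_cst; last exact: measurable_padic_ball.
by rewrite haar_ball // -EFinM ltry.
Qed.

(** As y <= (1 + y)^s, the bound of [CMO_ball_bound] dominates the deviation from the mean, and
    constants are integrable on balls. Only now is the integral in [ball_mean] known to converge and
    to be linear. *)
Lemma CMO_integrable k : mu.-integrable (ball k) (EFin \o b).
Proof.
have [M M0 hM] := CMO_ball_bound.
have mB := @measurable_padic_ball R p pr n k.
have ic := icst (ball_mean mu b k) k.
have id : mu.-integrable (ball k) (EFin \o (fun x => b x - ball_mean mu b k)).
  apply/integrableP; split.
    by apply/measurable_EFinP/measurable_funTS; exact: measurable_funB.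
  apply: le_lt_trans (ltry (M * (p%:R ^ k) ^+ n)).
  apply: le_trans (hM k).
  by apply: (@le_integral_EFin _ _ _ _ _ (fun x => `|b x - ball_mean mu b k|)).
have -> : EFin \o b = (EFin \o (fun x => b x - ball_mean mu b k)) \+
                      (EFin \o cst (ball_mean mu b k)).
  by apply/funext => x /=; rewrite -EFinD subrK.
exact: integrableD.
Qed.

(** The difference is the average over the smaller ball of b - c, where c is the mean over the
    larger one. Enlarging the domain of |b - c| to the larger ball costs the ratio p^n of the
    measures, hence D = M p^n. *)
Lemma CMO_mean_step : exists2 D : R, 0 <= D & forall k,
  `|ball_mean mu b k - ball_mean mu b (k + 1)| <= D.
Proof.
have [M M0 hM] := CMO_ball_bound.
exists (M * p%:R ^+ n); first by rewrite mulr_ge0 // exprn_ge0 // ltW.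
move=> k; set c := ball_mean mu b (k + 1).
have mB := @measurable_padic_ball R p pr n k.
have mB1 := @measurable_padic_ball R p pr n (k + 1).
have ic := icst c k.
have ib := CMO_integrable k.
have -> : ball_mean mu b k - c =
    ((p%:R ^ k) ^+ n)^-1 * \int[mu]_(x in ball k) (b x - c).
  rewrite (@RintegralB _ _ _ _ _ b (cst c)) // Rintegral_cst // /ball_mean haar_ball //=.
  by rewrite mulrBr [c * _]mulrC mulKf // gt_eqF.
rewrite normrM ger0_norm ?invr_ge0 ?(ltW (pXn_gt0 k)) // ler_pdivrMl //.
have ibc : mu.-integrable (ball k) (EFin \o (fun x => b x - c)).
  by have := integrableB mB ib ic.
apply: le_trans (le_normr_Rintegral mB ibc) _.
have -> : (p%:R ^ k) ^+ n * (M * p%:R ^+ n) = M * (p%:R ^ (k + 1)) ^+ n.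
  by rewrite expfzDr // expr1z exprMn; ring.
rewrite -lee_fin /Rintegral fineK; last first.
  by apply: integrable_fin_num => //; exact: (integrable_norm ibc).
apply: le_trans (hM (k + 1)).
apply: (@le_trans _ _ (\int[mu]_(x in ball (k + 1)) (`|b x - c|)%:E)%E).
  apply: ge0_subset_integral => //; first exact/measurable_EFinP.
  move=> x; rewrite /padic_ball /Qpn_ball /= => /le_trans; apply.
  by rewrite ler_eXz2l // lerDl.
exact: le_integral_EFin.
Qed.

Lemma CMO_shell_bound : exists2 M : R, 0 <= M & forall k,
  (\int[mu]_(x in shell k) (oscillation b x `^ s)%:E
     <= (M * (p%:R ^ k) ^+ n)%:E)%E.
Proof.
have [M M0 hM] := CMO_ball_bound; exists M; first exact: M0.
move=> k.
apply: le_trans (hM k).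
rewrite (eq_integral (fun x => ((1 + `|b x - ball_mean mu b k|) `^ s)%:E)); last first.
  move=> x /set_mem xk; rewrite /oscillation.
  by rewrite (xk : vabs x = _) radial_meanE.
apply: ge0_subset_integral => //.
- exact: measurable_padic_shell.
- exact: measurable_padic_ball.
- exact/measurable_EFinP.
- by rewrite padic_shellE; exact: subDsetl.
Qed.

(** If |x| = p^m |t|, the triangle inequality through the means at both radii leaves the two
    oscillations and a drift of at most D m, which the factor p^(em) dominates. *)
Lemma CMO_difference (e : R) : 0 < e -> exists2 C : R, 0 <= C &
  forall x t : V, t != 0 -> vabs t <= vabs x ->
  `|b x - b t| <= C * (vabs x `^ e * vabs t `^ (- e)) *
                  (oscillation b x * oscillation b t).
Proof.
move=> e0; have [D D0 hD] := CMO_mean_step.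
(* Chosen so that p^e = exp(c), whence (|x|/|t|)^e = exp(c m). *)
pose c := e * ln p%:R.
have c0 : 0 < c by rewrite mulr_gt0 // ln_gt0.
have drift k (m : nat) : `|ball_mean mu b (k + m%:Z) - ball_mean mu b k| <= D * m%:R.
  elim: m => [|m IH]; first by rewrite addr0 subrr normr0 mulr0.
  rewrite -(subrKA (ball_mean mu b (k + m%:Z))).
  apply: le_trans (ler_normD _ _) _; rewrite -natr1 mulrDr mulr1 addrC lerD //.
  by rewrite distrC -addn1 PoszD addrA; exact: hD.
(* From D m = (D/c)(c m): 1 + D m <= (1 + D/c)(1 + c m), and then 1 + c m <= exp(c m). *)
exists (1 + D / c); first by rewrite addr_ge0 // divr_ge0 // ltW.
move=> x t t0 tx.
have x0 : x != 0.
  by rewrite -(Qpn_abs_gt0 R) (lt_le_trans _ tx) // Qpn_abs_gt0.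
have [k xk] := Qpn_abs_value R x0; have [j tj] := Qpn_abs_value R t0.
have [m km] : exists m : nat, k = j + m%:Z.
  move: tx; rewrite xk tj ler_eXz2l // => jk.
  by exists `|k - j|%N; rewrite gez0_abs ?subr_ge0 // addrCA subrr addr0.
have ta : 0 < vabs t by rewrite Qpn_abs_gt0.
have -> : vabs x `^ e * vabs t `^ (- e) = expR (c * m%:R).
  have -> : vabs x = vabs t * p%:R ^+ m by rewrite xk tj km expfzDr.
  rewrite powRM ?exprn_ge0 // ?(ltW ta) // powRN mulrAC mulfV ?mul1r; last first.
    by rewrite gt_eqF // powR_gt0.
  rewrite /powR expf_eq0 (negbTE p_neq0) andbF lnXn //.
  by rewrite -[ln _ *+ _]mulr_natr mulrA.
have hb : `|b x - b t| <= (1 + D * m%:R) * (oscillation b x * oscillation b t).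
  have bx : radial_mean b (vabs x) = ball_mean mu b k by rewrite xk radial_meanE.
  have bt : radial_mean b (vabs t) = ball_mean mu b j by rewrite tj radial_meanE.
  rewrite /oscillation bx bt km.
  have := drift j m; set u := ball_mean mu b (j + m%:Z); set v := ball_mean mu b j.
  have := normr_ge0 (b x - u); have := normr_ge0 (b t - v).
  have : `|b x - b t| <= `|b x - u| + `|u - v| + `|b t - v|.
    have -> : b x - b t = (b x - u) + (u - v) - (b t - v) by ring.
    by apply: le_trans (ler_normB _ _) _; rewrite lerD2r ler_normD.
  have : 0 <= D * m%:R by rewrite mulr_ge0.
  move: `|b x - u| `|b t - v| `|u - v| (D * m%:R) => A B E F F0 h B0 A0 EF.
  by apply: le_trans h _; apply: le_trans (three_terms_le A0 B0 F0); rewrite lerD2r lerD2l.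
apply: le_trans hb _; rewrite ler_wpM2r ?mulr_ge0 ?oscillation_ge0 //.
apply: (@le_trans _ _ ((1 + D / c) * (1 + c * m%:R))).
  have m0 : 0 <= m%:R :> R by [].
  have Dc0 : 0 <= D / c by rewrite divr_ge0 // ltW.
  have cm0 : 0 <= c * m%:R by rewrite mulr_ge0 // ltW.
  have -> : D * m%:R = (D / c) * (c * m%:R) by rewrite mulrA divfK // gt_eqF.
  lra.
by rewrite ler_wpM2l ?expR_ge1Dx // addr_ge0 // divr_ge0 // ltW.
Qed.

End cmo.
End mean_oscillation.

(** * Schur's test for kernels with separated variables on a measurable relation *)

Section schur_test.
Context d (T : measurableType d) (R : realType).
Variable mu : {measure set T -> \bar R}.

(** Both sides are the iterated integrals of a(x) g(t) times the indicator of [E], which turns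
    sections into integrals over the whole space. *)
Lemma tonelli_sections (E : set (T * T)) (a g : T -> R) :
  sigma_finite setT mu -> measurable E ->
  measurable_fun setT a -> measurable_fun setT g ->
  (forall x, 0 <= a x) -> (forall t, 0 <= g t) ->
  (\int[mu]_x ((a x)%:E * \int[mu]_(t in xsection E x) (g t)%:E) =
   \int[mu]_t ((g t)%:E * \int[mu]_(x in ysection E t) (a x)%:E))%E.
Proof.
move=> sf mE ma mg a0 g0.
have Z (D : set T) (h : T -> R) k : measurable D -> measurable_fun setT h ->
    (forall x, 0 <= h x) -> 0 <= k ->
    (k%:E * \int[mu]_(x in D) (h x)%:E = \int[mu]_(x in D) (k * h x)%:E)%E.
  move=> mD mh h0 k0; rewrite -ge0_integralZl_EFin //.
    by move=> x _; rewrite lee_fin.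
  by apply/measurable_EFinP/measurable_funTS.
(* The same measure, bundled with the hypothesis [sf] as Tonelli's theorem requires. *)
pose m : {sigma_finite_measure set T -> \bar R} :=
  HB.pack (Measure.sort mu)
    (@Measure_isSigmaFinite.Axioms_ d T R (Measure.sort mu) _ _ sf).
pose F (z : T * T) : \bar R := (a z.1 * g z.2 * \1_E z)%:E.
have mF : measurable_fun setT F.
  apply/measurable_EFinP; apply: measurable_funM; last exact: measurable_indic.
  apply: measurable_funM.
    by apply: (measurableT_comp ma).
  by apply: (measurableT_comp mg).
have F0 z : (0 <= F z)%E by rewrite lee_fin !mulr_ge0.
have FT : (\int[mu]_x \int[mu]_y F (x, y) = \int[mu]_y \int[mu]_x F (x, y))%E.
  exact: (@fubini_tonelli _ _ T T R m m F mF F0).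
clearbody m.
transitivity (\int[mu]_x \int[mu]_y F (x, y))%E.
  apply: eq_integral => x _.
  rewrite (Z _ _ _ (measurable_xsection x mE) mg g0 (a0 x)).
  rewrite integral_mkcond; apply: eq_integral => t _.
  rewrite patchE mem_xsection /F indicE /=.
  by case: ifP => _; rewrite ?mulr1 ?mulr0.
rewrite FT; apply: eq_integral => t _.
rewrite (Z _ _ _ (measurable_ysection t mE) ma a0 (g0 t)).
rewrite [RHS]integral_mkcond; apply: eq_integral => x _.
rewrite patchE mem_ysection /F indicE /=.
by case: ifP => _; rewrite ?mulr1 ?mulr0 1?mulrC.
Qed.

(** Hoelder's inequality for the extensions by zero outside [D]; their norms see only [D] because
    0^r = 0 for r > 0. *)
Lemma hoelder_on (D : set T) (f g : T -> R) (q q' : R) :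
  measurable D -> measurable_fun setT f -> measurable_fun setT g ->
  (forall x, 0 <= f x) -> (forall x, 0 <= g x) ->
  0 < q -> 0 < q' -> q^-1 + q'^-1 = 1 ->
  (\int[mu]_(x in D) (f x * g x)%:E <=
     (\int[mu]_(x in D) (f x `^ q')%:E) `^ q'^-1 *
     (\int[mu]_(x in D) (g x `^ q)%:E) `^ q^-1)%E.
Proof.
move=> mD mf mg f0 g0 q0 q'0 qq'.
pose F x := f x * \1_D x; pose G x := g x * \1_D x.
have mF : measurable_fun setT F by apply: measurable_funM => //; exact: measurable_indic.
have mG : measurable_fun setT G by apply: measurable_funM => //; exact: measurable_indic.
have F0 x : 0 <= F x by rewrite mulr_ge0.
have G0 x : 0 <= G x by rewrite mulr_ge0.
have := @hoelder _ T R mu F G q' q mF mG q'0 q0.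
rewrite addrC => /(_ qq').
have aux (H h : T -> R) r : 0 < r -> (forall x, 0 <= h x) ->
    (forall x, H x = h x * \1_D x) ->
    Lnorm mu r%:E (EFin \o H) = ((\int[mu]_(x in D) (h x `^ r)%:E) `^ r^-1)%E.
  move=> r0 h0 Hh; rewrite unlock; congr (poweR _ _).
  rewrite [RHS]integral_mkcond; apply: eq_integral => x _.
  rewrite patchE /= Hh ger0_norm ?mulr_ge0 // indicE.
  by case: ifPn => xD; rewrite ?mulr1 // mulr0 powR0 // gt_eqF.
rewrite Lnorm1 (aux F f q' q'0 f0 (fun=> erefl)) (aux G g q q0 g0 (fun=> erefl)) => H.
apply: le_trans H; rewrite integral_mkcond le_eqVlt; apply/orP; left; apply/eqP.
apply: eq_integral => x _; rewrite patchE /F /G /= indicE.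
by case: ifPn => xD; rewrite ?mulr1 ?mulr0 ?normr0 // ger0_norm // mulr_ge0.
Qed.
End schur_test.

Section schur_test.
Context d (T : measurableType d) (R : realType).
Variables (mu : {measure set T -> \bar R}) (E : set (T * T)).
Hypotheses (sf : sigma_finite setT mu) (mE : measurable E).

Lemma measurable_section_integral (g : T -> R) :
  measurable_fun setT g -> (forall t, 0 <= g t) ->
  measurable_fun setT (fun x => \int[mu]_(t in xsection E x) (g t)%:E)%E /\
  measurable_fun setT (fun t => \int[mu]_(x in ysection E t) (g x)%:E)%E.
Proof.
move=> mg g0.
pose m : {sigma_finite_measure set T -> \bar R} := HB.pack (Measure.sort mu)
    (@Measure_isSigmaFinite.Axioms_ d T R (Measure.sort mu) _ _ sf).
have mF (F : T * T -> R) : measurable_fun setT F ->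
    measurable_fun setT (fun z => (F z * \1_E z)%:E).
  move=> mF; apply/measurable_EFinP; apply: measurable_funM; first exact: mF.
  exact: measurable_indic.
split.
  pose F (z : T * T) : \bar R := (g z.2 * \1_E z)%:E.
  have -> : (fun x => \int[mu]_(t in xsection E x) (g t)%:E)%E = fubini_F m F.
    apply/funext => x; rewrite /fubini_F integral_mkcond.
    apply: eq_integral => t _; rewrite patchE mem_xsection /F indicE /=.
    by case: ifP => _; rewrite ?mulr1 ?mulr0.
  apply: measurable_fun_fubini_tonelli_F.
    by apply: mF; exact: (measurableT_comp mg).
  by move=> z; rewrite lee_fin mulr_ge0.
pose F (z : T * T) : \bar R := (g z.1 * \1_E z)%:E.
have -> : (fun t => \int[mu]_(x in ysection E t) (g x)%:E)%E = fubini_G m F.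
  apply/funext => t; rewrite /fubini_G integral_mkcond.
  apply: eq_integral => x _; rewrite patchE mem_ysection /F indicE /=.
  by case: ifP => _; rewrite ?mulr1 ?mulr0.
apply: measurable_fun_fubini_tonelli_G.
  by apply: mF; exact: (measurableT_comp mg).
by move=> z; rewrite lee_fin mulr_ge0.
Qed.

Variables (q q' A B : R) (u v h k W f : T -> R).
Hypotheses (q_gt0 : 0 < q) (q'_gt0 : 0 < q') (qq' : q^-1 + q'^-1 = 1).
Hypotheses (A_ge0 : 0 <= A) (B_ge0 : 0 <= B).
Hypotheses (u0 : forall x, 0 <= u x) (v0 : forall x, 0 <= v x)
  (h0 : forall x, 0 <= h x) (k0 : forall x, 0 <= k x) (W0 : forall x, 0 <= W x).
Hypotheses (mu_meas : measurable_fun setT u) (mv : measurable_fun setT v)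
  (mh : measurable_fun setT h) (mk : measurable_fun setT k)
  (mW : measurable_fun setT W) (mf : measurable_fun setT f).
Hypothesis h_gt0 : forall x t, E (x, t) -> 0 < h t.
Hypothesis section_l : forall x,
  (\int[mu]_(t in xsection E x) ((v t * h t) `^ q')%:E <= (A * k x `^ q')%:E)%E.
Hypothesis section_r : forall t,
  (\int[mu]_(x in ysection E t) ((u x * k x) `^ q * W x)%:E
     <= (B * (h t `^ q * W t))%:E)%E.

Let mnf : measurable_fun setT (fun t => `|f t|).
Proof. exact: measurableT_comp. Qed.

Let mVh : measurable_fun setT (fun t => (h t)^-1).
Proof.
have -> : (fun t => (h t)^-1) = fun t => h t `^ (-1).
  by apply/funext => t; rewrite powR_inv1.
exact: (measurableT_comp (measurable_powR _)).
Qed.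

Let mg : measurable_fun setT (fun t => (`|f t| / h t) `^ q).
Proof.
apply: (measurableT_comp (measurable_powR _)); exact: measurable_funM.
Qed.

(** Hoelder for v |f| = (v h)(|f| / h), with [h] as test weight; [section_l] bounds the first
    factor. Positivity of [h] is needed only on the section. *)
Lemma schur_pointwise x :
  (\int[mu]_(t in xsection E x) (v t * `|f t|)%:E <=
     (A `^ q'^-1 * k x)%:E *
     (\int[mu]_(t in xsection E x) ((`|f t| / h t) `^ q)%:E) `^ q^-1)%E.
Proof.
have mX := measurable_xsection x mE.
rewrite (eq_integral (fun t => ((v t * h t) * (`|f t| / h t))%:E)); last first.
  move=> t; rewrite mem_xsection => /set_mem /h_gt0 ht.
  by rewrite mulrACA divff ?mulr1 // gt_eqF.
apply: le_trans (hoelder_on mu mX _ _ _ _ q_gt0 q'_gt0 qq') _.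
- exact: measurable_funM.
- exact: measurable_funM.
- by move=> t; rewrite mulr_ge0.
- by move=> t; rewrite mulr_ge0 // invr_ge0.
apply: lee_wpmul2r; first exact: poweR_ge0.
have -> : A `^ q'^-1 * k x = (A * k x `^ q') `^ q'^-1.
  rewrite powRM ?powR_ge0 // -powRrM mulfV ?powRr1 //.
  by rewrite gt_eqF.
rewrite -poweR_EFin; apply: gt0_ler_poweR; last exact: section_l.
- by rewrite invr_ge0 ltW.
- rewrite in_itv /= leey andbT; apply: integral_ge0 => t _.
  by rewrite lee_fin powR_ge0.
- by rewrite in_itv /= leey andbT lee_fin mulr_ge0 // powR_ge0.
Qed.

(** The [q]-th power of [schur_pointwise] is integrated in x and Tonelli moves the x-integral
    inside; [section_r] then returns h^q W, whose h^q cancels the one in the denominator. The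
    constant A^(q/q') is the [q]-th power of A^(1/q'). *)
Lemma schur_test :
  (\int[mu]_x ((u x `^ q * W x)%:E *
      (\int[mu]_(t in xsection E x) (v t * `|f t|)%:E) `^ q) <=
   (A `^ (q / q') * B)%:E * \int[mu]_t (`|f t| `^ q * W t)%:E)%E.
Proof.
pose N x := (\int[mu]_(t in xsection E x) ((`|f t| / h t) `^ q)%:E)%E.
have N0 x : (0 <= N x)%E by apply: integral_ge0 => t _; rewrite lee_fin powR_ge0.
have mN : measurable_fun setT N.
  by apply: (measurable_section_integral _ _).1 => // t; exact: powR_ge0.
pose a x := (u x * k x) `^ q * W x.
have a0 x : 0 <= a x by rewrite mulr_ge0 // powR_ge0.
have ma : measurable_fun setT a.
  apply: measurable_funM => //; apply: (measurableT_comp (measurable_powR _)).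
  exact: measurable_funM.
have c0 : 0 <= A `^ (q / q') by exact: powR_ge0.
apply: (@le_trans _ _ (\int[mu]_x ((A `^ (q / q'))%:E * ((a x)%:E * N x)))%E).
  apply: ge0_le_integral => //.
  - by move=> x _; rewrite mule_ge0 ?poweR_ge0 // lee_fin mulr_ge0 // powR_ge0.
  - apply: emeasurable_funM.
      apply/measurable_EFinP; apply: measurable_funM => //.
      exact: (measurableT_comp (measurable_powR _)).
    apply: (measurableT_comp (measurable_poweR _)).
    apply: (measurable_section_integral _ _).1; first exact: measurable_funM.
    by move=> t; rewrite mulr_ge0.
  - apply: measurable_funeM; apply: emeasurable_funM => //.
    exact/measurable_EFinP.
  - move=> x _.
    have e : (A `^ q'^-1 * k x) `^ q = A `^ (q / q') * k x `^ q.
      by rewrite powRM ?powR_ge0 // -powRrM [q'^-1 * q]mulrC.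
    have I_le : ((\int[mu]_(t in xsection E x) (v t * `|f t|)%:E) `^ q <=
        (A `^ (q / q') * k x `^ q)%:E * N x)%E.
      have -> : ((A `^ (q / q') * k x `^ q)%:E * N x =
          ((A `^ q'^-1 * k x)%:E * N x `^ q^-1) `^ q)%E.
        rewrite poweRM ?poweR_ge0 ?lee_fin ?mulr_ge0 ?powR_ge0 //.
        rewrite -poweRrM mulVf ?poweRe1 ?gt_eqF // poweR_EFin.
        by rewrite e.
      apply: gt0_ler_poweR; last exact: schur_pointwise.
      - exact: ltW.
      - rewrite in_itv /= leey andbT; apply: integral_ge0 => t _.
        by rewrite lee_fin mulr_ge0.
      - by rewrite in_itv /= leey andbT mule_ge0 ?poweR_ge0 // lee_fin mulr_ge0 ?powR_ge0.
    apply: le_trans (lee_wpmul2l _ I_le) _; first by rewrite lee_fin mulr_ge0 ?powR_ge0.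
    rewrite !muleA -!EFinM /a powRM //.
    rewrite le_eqVlt; apply/orP; left; apply/eqP; congr (_%:E * _)%E; ring.
rewrite ge0_integralZl_EFin //; first last.
- by apply: emeasurable_funM => //; exact/measurable_EFinP.
- by move=> x _; rewrite mule_ge0 ?lee_fin.
rewrite EFinM -muleA; apply: lee_wpmul2l => //.
rewrite (tonelli_sections sf mE ma mg a0) => [|t]; last exact: powR_ge0.
have mfW : measurable_fun setT (fun t => `|f t| `^ q * W t).
  apply: measurable_funM => //; exact: (measurableT_comp (measurable_powR _)).
rewrite -ge0_integralZl_EFin //; first last.
- exact/measurable_EFinP.
- by move=> t _; rewrite lee_fin mulr_ge0 // powR_ge0.
apply: ge0_le_integral => //.
- move=> t _; rewrite mule_ge0 ?lee_fin ?powR_ge0 //.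
  by apply: integral_ge0 => x _; rewrite lee_fin.
- apply: emeasurable_funM; first exact/measurable_EFinP.
  exact: (measurable_section_integral ma a0).2.
- by apply: measurable_funeM; exact/measurable_EFinP.
move=> t _; apply: le_trans (lee_wpmul2l _ (section_r t)) _.
  by rewrite lee_fin powR_ge0.
rewrite -EFinM lee_fin mulrCA ler_wpM2l // mulrA ler_wpM2r //.
(* [t] now ranges over the whole space, where [h] may vanish; then the left side is 0, since 0^q =
   0. *)
have [ht|ht] := eqVneq (h t) 0.
  by rewrite ht powR0 ?mulr0 ?powR_ge0 // gt_eqF.
rewrite -powRM ?divr_ge0 // divfK //.
Qed.

End schur_test.

(** * Power weights integrated over balls and their complements *)

Lemma geometric_integral_le d (T : measurableType d) (R : realType)
    (mu : {measure set T -> \bar R}) (F : (set T)^nat) (f : T -> \bar R) (c r : R) :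
  (forall i, measurable (F i)) -> trivIset setT F ->
  measurable_fun setT f -> (forall x, 0 <= f x)%E ->
  0 <= c -> 0 <= r -> r < 1 ->
  (forall i, (\int[mu]_(x in F i) f x <= (c * r ^+ i)%:E)%E) ->
  (\int[mu]_(x in \bigcup_i F i) f x <= (c / (1 - r))%:E)%E.
Proof.
move=> mF tF mf f0 c0 r0 r1 hF.
rewrite ge0_integral_bigcup //; last exact: measurable_funTS.
apply: lime_le.
  by apply: is_cvg_nneseries => i _ _; exact: integral_ge0.
apply: nearW => m; apply: (@le_trans _ _ (\sum_(0 <= i < m) (c * r ^+ i)%:E)%E).
  by apply: lee_sum => i _; exact: hF.
rewrite sumEFin lee_fin ler_pdivlMr ?subr_gt0 //.
have -> : (\sum_(0 <= i < m) c * r ^+ i) * (1 - r) = c * (1 - r ^+ m).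
  elim: m => [|m IH]; first by rewrite big_nil expr0 subrr mul0r mulr0.
  by rewrite big_nat_recr //= mulrDl IH exprS; ring.
by rewrite ler_piMr // gerBl exprn_ge0.
Qed.

Section shell_integrals.
Variables (R : realType) (p : nat) (pr : prime p) (n : nat).
Local Notation V := (Qpn pr n).
Local Notation vabs := (@Qpn_abs R p pr n).
Local Notation shell := (@padic_shell R p pr n).
Variable mu : {measure set V -> \bar R}.

Let p_gt0 : 0 < p%:R :> R. Proof. by rewrite ltr0n prime_gt0. Qed.
Let p_neq0 : p%:R != 0 :> R. Proof. exact: lt0r_neq0. Qed.
Let p_gt1 : 1 < p%:R :> R. Proof. by rewrite ltr1n prime_gt1. Qed.

(* Both relations exclude points of norm 0, where [powR] takes junk values. *)
Definition padic_le : set (V * V) := [set z | 0 < vabs z.2 <= vabs z.1].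
Definition padic_ge : set (V * V) := [set z | 0 < vabs z.1 <= vabs z.2].

Let mlt (f : V * V -> R) : measurable_fun setT f -> measurable [set z | 0 < f z].
Proof.
move=> mf; rewrite [X in measurable X](_ : _ = (fun z => 0 < f z) @^-1` [set true]).
  by rewrite -[X in measurable X]setTI; apply: measurable_fun_ltr.
by apply/seteqP; split.
Qed.

Let mle (f g : V * V -> R) : measurable_fun setT f -> measurable_fun setT g ->
  measurable [set z | f z <= g z].
Proof.
move=> mf mg; rewrite [X in measurable X](_ : _ = (fun z => f z <= g z) @^-1` [set true]).
  by rewrite -[X in measurable X]setTI; apply: measurable_fun_ler.
by apply/seteqP; split.
Qed.

Let m1 : measurable_fun setT (fun z : V * V => vabs z.1).
Proof. exact: (measurableT_comp (@measurable_Qpn_abs R p pr n)). Qed.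

Let m2 : measurable_fun setT (fun z : V * V => vabs z.2).
Proof. exact: (measurableT_comp (@measurable_Qpn_abs R p pr n)). Qed.

Lemma measurable_padic_le : measurable padic_le.
Proof.
rewrite (_ : padic_le = [set z | 0 < vabs z.2] `&` [set z | vabs z.2 <= vabs z.1]).
  by apply: measurableI; [exact: mlt|exact: mle].
by apply/seteqP; split => z /=; [move/andP|move=> h; apply/andP].
Qed.

Lemma measurable_padic_ge : measurable padic_ge.
Proof.
rewrite (_ : padic_ge = [set z | 0 < vabs z.1] `&` [set z | vabs z.1 <= vabs z.2]).
  by apply: measurableI; [exact: mlt|exact: mle].
by apply/seteqP; split => z /=; [move/andP|move=> h; apply/andP].
Qed.

Variables (w : V -> R) (M : R).
Hypotheses (mw : measurable_fun setT w) (w_ge0 : forall x, 0 <= w x) (M_ge0 : 0 <= M).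
Hypothesis w_shell : forall k,
  (\int[mu]_(x in shell k) (w x)%:E <= (M * (p%:R ^ k) ^+ n)%:E)%E.

Let mwpow g : measurable_fun setT (fun x => w x * vabs x `^ g).
Proof. by apply: measurable_funM => //; exact: (measurable_radial (@powR R ^~ g)). Qed.

(** Writing the exponent as g - n lets |x|^(-n) cancel the factor p^(kn) of [w_shell], so [g] alone
    is the growth rate along the shells. *)
Lemma shell_integral_le (g : R) (k : int) :
  (\int[mu]_(x in shell k) (w x * vabs x `^ (g - n%:R))%:E <=
     (M * (p%:R ^ k) `^ g)%:E)%E.
Proof.
rewrite (eq_integral (fun x => ((p%:R ^ k) `^ (g - n%:R))%:E * (w x)%:E)%E); last first.
  by move=> x /set_mem xk; rewrite -EFinM (xk : vabs x = _) mulrC.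
rewrite ge0_integralZl_EFin ?powR_ge0 //; first last.
- by apply/measurable_EFinP/measurable_funTS.
- by move=> x _; rewrite lee_fin.
- exact: measurable_padic_shell.
apply: le_trans (lee_wpmul2l _ (w_shell k)) _; first by rewrite lee_fin powR_ge0.
have pk : 0 < p%:R ^ k :> R by rewrite exprz_gt0.
rewrite -EFinM lee_fin mulrCA -powR_mulrn ?(ltW pk) // -powRD ?subrK //.
by apply/implyP => _; rewrite gt_eqF.
Qed.

(** One statement for both directions: e = -1 runs towards the origin, e = 1 towards infinity. The
    ratio of the geometric series is p^(e g), and [e != 0] keeps the shells disjoint. *)
Let shells_integral_le (e : int) (g : R) (k : int) : e != 0 -> (p%:R ^ e) `^ g < 1 ->
  (\int[mu]_(x in \bigcup_(i : nat) shell (k + e * i%:Z)%R)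
      (w x * vabs x `^ (g - n%:R))%:E <=
     (M * (p%:R ^ k) `^ g / (1 - (p%:R ^ e) `^ g))%:E)%E.
Proof.
move=> e0 r1; have pg0 (j : int) : 0 <= p%:R ^ j :> R by rewrite exprz_ge0 // ltW.
apply: geometric_integral_le => //.
- by move=> i; exact: measurable_padic_shell.
- apply/trivIsetP => i j _ _; apply: contra_neqP => /eqP/set0P[x []].
  rewrite /padic_shell /= => ->.
  by move=> /(ieexprIz p_gt0 (negbT (gt_eqF p_gt1))) /addrI /(mulfI e0) [].
- exact/measurable_EFinP.
- by move=> x; rewrite lee_fin mulr_ge0 // powR_ge0.
- by rewrite mulr_ge0 // powR_ge0.
- exact: powR_ge0.
move=> i; apply: le_trans (shell_integral_le _ _) _; rewrite lee_fin.
have -> : (p%:R ^ (k + e * i%:Z)) `^ g = (p%:R ^ k) `^ g * (p%:R ^ e) `^ g ^+ i.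
  rewrite expfzDr // powRM // -exprz_exp -exprnP; congr (_ * _).
  rewrite -(powR_mulrn i (pg0 e)) powRAC; exact: powR_mulrn (powR_ge0 _ _).
by rewrite mulrA.
Qed.

Definition inner (x : V) : set V := [set t | 0 < vabs t <= vabs x].
Definition outer (x : V) : set V := [set t | 0 < vabs x <= vabs t].

Lemma xsection_padic_le x : xsection padic_le x = inner x.
Proof. by apply/seteqP; split => t; rewrite /xsection /padic_le /inner /= inE. Qed.

Lemma ysection_padic_le x : ysection padic_le x = outer x.
Proof. by apply/seteqP; split => t; rewrite /ysection /padic_le /outer /= inE. Qed.

Lemma xsection_padic_ge x : xsection padic_ge x = outer x.
Proof. by apply/seteqP; split => t; rewrite /xsection /padic_ge /outer /= inE. Qed.

Lemma ysection_padic_ge x : ysection padic_ge x = inner x.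
Proof. by apply/seteqP; split => t; rewrite /ysection /padic_ge /inner /= inE. Qed.

Lemma inner_shells x k : vabs x = p%:R ^ k ->
  inner x = \bigcup_(i : nat) shell (k + -1 * i%:Z)%R.
Proof.
move=> xk; apply/seteqP; split => t; rewrite /inner /padic_shell /= ?xk.
  move=> /andP[]; rewrite Qpn_abs_gt0 => /(Qpn_abs_value R)[j tj].
  rewrite tj ler_eXz2l // => jk; exists `|k - j|%N => //=.
  by rewrite gez0_abs ?subr_ge0 // mulN1r subKr.
by move=> [i _ /= ->]; rewrite exprz_gt0 //= ler_eXz2l // mulN1r gerBl.
Qed.

Lemma outer_shells x k : vabs x = p%:R ^ k ->
  outer x = \bigcup_(i : nat) shell (k + 1 * i%:Z)%R.
Proof.
move=> xk; apply/seteqP; split => t; rewrite /outer /padic_shell /= ?xk.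
  move=> /andP[k0 kt]; have : 0 < vabs t by exact: lt_le_trans kt.
  rewrite Qpn_abs_gt0 => /(Qpn_abs_value R)[j tj].
  move: kt; rewrite tj ler_eXz2l // => kj; exists `|j - k|%N => //=.
  by rewrite gez0_abs ?subr_ge0 // mul1r addrCA subrr addr0.
by move=> [i _ /= ->]; rewrite exprz_gt0 //= ler_eXz2l // mul1r lerDl.
Qed.

Let ppow_lt1 (g : R) : g < 0 -> p%:R `^ g < 1 :> R.
Proof. by move=> g0; rewrite /powR (negbTE p_neq0) expR_lt1 nmulr_rlt0 // ln_gt0. Qed.

Lemma inner_integral_le (g : R) : 0 < g -> exists2 C : R, 0 <= C & forall x,
  (\int[mu]_(t in inner x) (w t * vabs t `^ (g - n%:R))%:E <=
     (C * vabs x `^ g)%:E)%E.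
Proof.
move=> g0; have r1 : (p%:R ^ (-1 : int)) `^ g < 1 :> R.
  rewrite exprN1 -powR_inv1 ?(ltW p_gt0) // -powRrM mulN1r.
  by apply: ppow_lt1; rewrite oppr_lt0.
exists (M / (1 - (p%:R ^ (-1 : int)) `^ g)).
  by rewrite divr_ge0 // subr_ge0 ltW.
(* For x = 0 there is no shell to start from, but the domain is empty. *)
move=> x; have [->|/(Qpn_abs_value R)[k xk]] := eqVneq x 0.
  rewrite [inner 0](_ : _ = set0) ?integral_set0.
    by rewrite lee_fin mulr_ge0 ?powR_ge0 // divr_ge0 // subr_ge0 ltW.
  apply/seteqP; split => t //; rewrite /inner /=.
  by rewrite Qpn_abs0 => /andP[]; case: ltgtP.
rewrite (inner_shells xk) xk mulrAC; exact: shells_integral_le.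
Qed.

Lemma outer_integral_le (g : R) : g < 0 -> exists2 C : R, 0 <= C & forall x,
  (\int[mu]_(t in outer x) (w t * vabs t `^ (g - n%:R))%:E <=
     (C * vabs x `^ g)%:E)%E.
Proof.
move=> g0; have r1 : (p%:R ^ (1 : int)) `^ g < 1 :> R.
  by rewrite expr1z; exact: ppow_lt1.
exists (M / (1 - (p%:R ^ (1 : int)) `^ g)).
  by rewrite divr_ge0 // subr_ge0 ltW.
move=> x; have [->|/(Qpn_abs_value R)[k xk]] := eqVneq x 0.
  rewrite [outer 0](_ : _ = set0) ?integral_set0.
    by rewrite lee_fin mulr_ge0 ?powR_ge0 // divr_ge0 // subr_ge0 ltW.
  apply/seteqP; split => t //; rewrite /outer /=.
  by rewrite Qpn_abs0 ltxx.
rewrite (outer_shells xk) xk mulrAC; exact: shells_integral_le.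
Qed.


End shell_integrals.

(** Passes from the domain [D] of the operator to the section [S] of the relation. Up to a null set
    [D] lies in [S]: the ball exceeds its section by the origin, while the complement of the ball is
    smaller, as its section also contains the sphere through x. Here [beta] stands for b(x). *)
Lemma kernel_integral_bound d (T : measurableType d) (R : realType)
    (mu : {measure set T -> \bar R}) (D S : set T) (F G b : T -> R) (beta c1 c2 : R) :
  measurable D -> measurable S -> mu (D `\` S) = 0%E ->
  measurable_fun setT F -> measurable_fun setT G -> measurable_fun setT b ->
  (forall t, 0 <= G t) -> (\int[mu]_(t in S) (G t)%:E < +oo)%E -> 0 <= c2 ->
  (forall t, S t -> `|F t| <= c1 * G t) ->
  (forall t, S t -> `|beta - b t| * `|F t| <= c2 * G t) ->
  [/\ mu.-integrable D (EFin \o F),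
      mu.-integrable D (EFin \o (fun t => b t * F t)) &
      ((`|beta * \int[mu]_(t in D) F t - \int[mu]_(t in D) (b t * F t)|)%:E
        <= c2%:E * \int[mu]_(t in S) (G t)%:E)%E].
Proof.
move=> mD mS muDS mF mG mb G0 IG c20 hF hb.
have mN : measurable (D `\` S) by exact: measurableD.
have Dnull (H : T -> R) : measurable_fun setT H -> (forall t, 0 <= H t) ->
    (\int[mu]_(t in D) (H t)%:E <= \int[mu]_(t in S) (H t)%:E)%E.
  move=> mH H0; rewrite (ge0_negligible_integral mN mD) //; last 2 first.
  - exact/measurable_EFinP/measurable_funTS.
  - by move=> t _; rewrite lee_fin.
  apply: ge0_subset_integral => //; first exact: measurableD.
  - exact/measurable_EFinP/measurable_funTS.
  - by move=> t _; rewrite lee_fin.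
  - by move=> t [Dt /not_andP[]//]; rewrite notK.
have dom (H : T -> R) (c : R) : 0 <= c -> measurable_fun setT H ->
    (forall t, S t -> `|H t| <= c * G t) ->
    (\int[mu]_(t in D) (`|H t|)%:E <= c%:E * \int[mu]_(t in S) (G t)%:E)%E.
  move=> c0 mH hH.
  have mnH : measurable_fun setT (fun t => `|H t|) by exact: measurableT_comp.
  apply: le_trans (Dnull _ mnH (fun t => normr_ge0 _)) _.
  rewrite -ge0_integralZl_EFin //; first last.
  - exact/measurable_EFinP/measurable_funTS.
  - by move=> t _; rewrite lee_fin.
  apply: le_integral_EFin => //.
  - exact: measurable_funTS.
  - by apply: measurable_funTS; exact: measurable_funM.
have intg (H : T -> R) (c : R) : measurable_fun setT H ->
    (forall t, S t -> `|H t| <= c * G t) -> mu.-integrable D (EFin \o H).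
  move=> mH hH; apply/integrableP; split.
    exact/measurable_EFinP/measurable_funTS.
  have hH' t : S t -> `|H t| <= `|c| * G t.
    by move=> St; apply: le_trans (hH t St) _; rewrite ler_wpM2r // ler_norm.
  apply: le_lt_trans (dom H `|c| _ mH hH') _ => //.
  by rewrite lte_mul_pinfty // lee_fin.
have iF : mu.-integrable D (EFin \o F) by exact: intg hF.
have ibF : mu.-integrable D (EFin \o (fun t => b t * F t)).
  (* From b F = beta F - (beta - b) F, one constant for each term. *)
  apply: (intg _ (`|beta| * c1 + c2)); first exact: measurable_funM.
  move=> t St; rewrite normrM.
  have -> : b t = beta - (beta - b t) by rewrite opprB addrC subrK.
  apply: (@le_trans _ _ ((`|beta| + `|beta - b t|) * `|F t|)).
    by rewrite ler_wpM2r // ler_normB.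
  rewrite mulrDl mulrDl lerD ?hb // -mulrA ler_wpM2l //; exact: hF.
split => //.
have ibetaF : mu.-integrable D (EFin \o (fun t => beta * F t)).
  by have := integrableZl mD beta iF.
rewrite -RintegralZl // -RintegralB //.
have iB : mu.-integrable D (EFin \o (fun t => beta * F t - b t * F t)).
  by have := integrableB mD ibetaF ibF.
apply: le_trans (_ : (\int[mu]_(t in D) `|beta * F t - b t * F t|)%:E <= _)%E.
  by rewrite lee_fin; exact: le_normr_Rintegral.
rewrite /Rintegral fineK; last first.
  by apply: integrable_fin_num => //; exact: (integrable_norm iB).
apply: (dom (fun t => beta * F t - b t * F t)) => //.
  by apply: measurable_funB; exact: measurable_funM.
by move=> t St; rewrite -mulrBl normrM; exact: hb.
Qed.

Lemma ler_powRN (R : realType) (r y z : R) :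
  0 <= r -> 0 < y -> y <= z -> z `^ (- r) <= y `^ (- r).
Proof.
move=> r0 y0 yz; have z0 := lt_le_trans y0 yz.
rewrite !powRN lef_pV2 ?posrE ?powR_gt0 //.
by apply: ge0_ler_powR => //; rewrite nnegrE ltW.
Qed.

(** * Choice of exponents and the two weighted bounds *)

Section weighted_estimates.
Variables (R : realType) (p : nat) (pr : prime p) (n : nat).
Local Notation V := (Qpn pr n).
Local Notation vabs := (@Qpn_abs R p pr n).
Local Notation shell := (@padic_shell R p pr n).
Local Notation inner := (@inner R p pr n).
Local Notation outer := (@outer R p pr n).
Local Notation padic_le := (@padic_le R p pr n).
Local Notation padic_ge := (@padic_ge R p pr n).
Variable mu : {measure set V -> \bar R}.
Hypotheses (n_gt0 : (0 < n)%N) (haar : normalized_haar mu).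
Variables (alpha q q' : R) (b : V -> R).
Hypotheses (q_gt1 : 1 < q) (qq' : q^-1 + q'^-1 = 1).
Hypothesis b_CMO : CMO mu (Num.max q' q) b.

Local Notation osc := (oscillation mu b).

Let q_gt0 : 0 < q. Proof. exact: lt_trans q_gt1. Qed.
Let q'V : q'^-1 = 1 - q^-1. Proof. by rewrite -qq' addrC addKr. Qed.
Let q'_gt0 : 0 < q'. Proof. by rewrite -invr_gt0 q'V subr_gt0 invf_lt1. Qed.
Let mb : measurable_fun setT b. Proof. exact: b_CMO.1.1. Qed.
Let mosc : measurable_fun setT osc. Proof. exact: measurable_oscillation. Qed.
Let osc_ge0 x : 0 <= osc x. Proof. exact: oscillation_ge0. Qed.
Let mvabs g : measurable_fun setT (fun x : V => vabs x `^ g).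
Proof. exact: (measurable_radial (@powR R ^~ g)). Qed.
Let max_ge1 : 1 <= Num.max q' q. Proof. by rewrite le_max (ltW q_gt1) orbT. Qed.

(** Since the oscillation is at least 1, its power [r] is below its power max(q', q), which the CMO
    condition controls. *)
Lemma osc_powR_shell (r : R) : 0 < r -> r <= Num.max q' q ->
  exists2 M : R, 0 <= M & forall k,
  (\int[mu]_(x in shell k) (osc x `^ r)%:E <= (M * (p%:R ^ k) ^+ n)%:E)%E.
Proof.
move=> r0 rs; have [M M0 hM] := CMO_shell_bound haar max_ge1 b_CMO.
exists M; first exact: M0.
move=> k; apply: le_trans (hM k).
apply: le_integral_EFin.
- exact: measurable_padic_shell.
- by apply: measurable_funTS; apply: (measurableT_comp (measurable_powR _)).
- by apply: measurable_funTS; apply: (measurableT_comp (measurable_powR _)).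
- by move=> x _; exact: powR_ge0.
- by move=> x _; apply: ler_powR => //; exact: oscillation_ge1.
Qed.

Let mosc_powR r : measurable_fun setT (fun x => osc x `^ r).
Proof. exact: (measurableT_comp (measurable_powR _)). Qed.

Lemma osc_inner (r g : R) : 0 < r -> r <= Num.max q' q -> 0 < g ->
  exists2 C : R, 0 <= C & forall x, (\int[mu]_(t in inner x)
    (osc t `^ r * vabs t `^ (g - n%:R))%:E <= (C * vabs x `^ g)%:E)%E.
Proof.
move=> r0 rs g0; have [M M0 hM] := osc_powR_shell r0 rs.
exact: (inner_integral_le (mosc_powR r) (fun x => powR_ge0 _ _) M0 hM).
Qed.

Lemma osc_outer (r g : R) : 0 < r -> r <= Num.max q' q -> g < 0 ->
  exists2 C : R, 0 <= C & forall x, (\int[mu]_(t in outer x)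
    (osc t `^ r * vabs t `^ (g - n%:R))%:E <= (C * vabs x `^ g)%:E)%E.
Proof.
move=> r0 rs g0; have [M M0 hM] := osc_powR_shell r0 rs.
exact: (outer_integral_le (mosc_powR r) (fun x => powR_ge0 _ _) M0 hM).
Qed.

(** Schur's test with pure powers of the norm as test functions; [g1] and [g2] are the growth rates
    of the left and right section integrals. The hypothesis [mono] serves the finiteness of the
    section integrals, which is needed before the operator makes sense. *)
Lemma osc_kernel_bound (E : set (V * V)) (a c sigma : R) :
  measurable E ->
  (forall x t, E (x, t) -> 0 < vabs x /\ 0 < vabs t) ->
  a + c = - n%:R ->
  forall g1 g2 : R, g1 = (c + sigma) * q' + n%:R -> g2 = sigma * q + alpha ->
  (exists2 A : R, 0 <= A & forall x, (\int[mu]_(t in xsection E x)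
    (osc t `^ q' * vabs t `^ (g1 - n%:R))%:E <= (A * vabs x `^ g1)%:E)%E) ->
  (exists2 B : R, 0 <= B & forall t, (\int[mu]_(x in ysection E t)
    (osc x `^ q * vabs x `^ (g2 - n%:R))%:E <= (B * vabs t `^ g2)%:E)%E) ->
  (forall x t, E (x, t) -> vabs t `^ (- g2) <= vabs x `^ (- g2)) ->
  exists2 C : R, 0 <= C & forall f : V -> R, weighted_L mu q alpha f ->
    (forall x, \int[mu]_(t in xsection E x)
       (osc t * vabs t `^ c * `|f t|)%:E < +oo)%E /\
    (\int[mu]_x (((osc x * vabs x `^ a) `^ q * vabs x `^ alpha)%:E *
      (\int[mu]_(t in xsection E x) (osc t * vabs t `^ c * `|f t|)%:E) `^ q) <=
     C%:E * \int[mu]_x (`|f x| `^ q * vabs x `^ alpha)%:E)%E.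
Proof.
move=> mE E0 ac g1 g2 g1E g2E [A A0 hA] [B B0 hB] mono.
pose h t := vabs t `^ sigma; pose k x := vabs x `^ (g1 / q').
pose u x := osc x * vabs x `^ a; pose v t := osc t * vabs t `^ c.
pose W x := vabs x `^ alpha.
have g1q : g1 / q' = c + sigma + n%:R / q' by rewrite g1E mulrDl mulfK // gt_eqF.
have u0 x : 0 <= u x by rewrite mulr_ge0 ?powR_ge0.
have v0 x : 0 <= v x by rewrite mulr_ge0 ?powR_ge0.
have mu_meas : measurable_fun setT u by exact: measurable_funM.
have mv : measurable_fun setT v by exact: measurable_funM.
have h_gt0 x t : E (x, t) -> 0 < h t by move=> /E0[_ t0]; exact: powR_gt0.
have pD (y r s : R) : 0 < y -> y `^ r * y `^ s = y `^ (r + s).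
  by move=> y0; rewrite powRD //; apply/implyP => _; rewrite gt_eqF.
have sl x : (\int[mu]_(t in xsection E x) ((v t * h t) `^ q')%:E <=
    (A * k x `^ q')%:E)%E.
  have -> : k x `^ q' = vabs x `^ g1 by rewrite /k -powRrM divfK // gt_eqF.
  apply: le_trans (hA x); rewrite le_eqVlt; apply/orP; left; apply/eqP.
  apply: eq_integral => t; rewrite mem_xsection => /set_mem /E0[_ t0].
  rewrite /v /h -mulrA pD // powRM ?powR_ge0 // -powRrM.
  by rewrite g1E addrK.
have sr t : (\int[mu]_(x in ysection E t) ((u x * k x) `^ q * W x)%:E <=
    (B * (h t `^ q * W t))%:E)%E.
  (* Powers of 0 do not add in the exponent, but the section at the origin is empty. *)
  have [->|t0] := eqVneq t 0.
    rewrite [ysection E 0](_ : _ = set0) ?integral_set0.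
      by rewrite lee_fin !mulr_ge0 ?powR_ge0.
    apply/seteqP; split => x //; rewrite /ysection /= => /set_mem /E0[_].
    by rewrite Qpn_abs_gt0 eqxx.
  have -> : h t `^ q * W t = vabs t `^ g2.
    by rewrite /h /W g2E -powRrM pD // Qpn_abs_gt0.
  apply: le_trans (hB t); rewrite le_eqVlt; apply/orP; left; apply/eqP.
  apply: eq_integral => x; rewrite mem_ysection => /set_mem /E0[x0 _].
  rewrite /u /k /W -mulrA pD // powRM ?powR_ge0 // -powRrM -mulrA pD //.
  (* The exponents agree because a + c = -n: a + g1/q' = -n + sigma + n/q' = sigma - n/q, and [q]
     times this plus alpha is g2 - n. *)
  congr (_ * _ `^ _)%:E; rewrite g1q g2E.
  rewrite q'V.
  have -> : c = - n%:R - a by rewrite -ac addrAC subrr add0r.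
  by field; rewrite gt_eqF.
exists (A `^ (q / q') * B); first by rewrite mulr_ge0 // powR_ge0.
move=> f [mf f_fin].
have k0 x : 0 <= k x by exact: powR_ge0.
have h0 x : 0 <= h x by exact: powR_ge0.
have W0 x : 0 <= W x by exact: powR_ge0.
have mh : measurable_fun setT h by exact: mvabs.
have mk : measurable_fun setT k by exact: mvabs.
have mW : measurable_fun setT W by exact: mvabs.
split; last first.
  exact: (schur_test (haar_sigma_finite haar) mE q_gt0 q'_gt0 qq' A0 B0
    u0 v0 h0 k0 W0 mu_meas mv mh mk mW mf h_gt0 sl sr).
move=> x; apply: le_lt_trans (schur_pointwise mE q_gt0 q'_gt0 qq' A0
  v0 h0 k0 mv mh mf h_gt0 sl x) _.
apply: lte_mul_pinfty => //; first by rewrite lee_fin mulr_ge0 ?powR_ge0.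
apply: poweR_lty.
have mfW : measurable_fun setT (fun t => `|f t| `^ q * W t).
  apply: measurable_funM => //; apply: (measurableT_comp (measurable_powR _)).
  exact: measurableT_comp.
have fW0 t : 0 <= `|f t| `^ q * W t by rewrite mulr_ge0 ?powR_ge0.
have mX := measurable_xsection x mE.
(* On the section (|f|/h)^q = |t|^(-g2) |f|^q W, and [mono] replaces |t| by the fixed |x|; what
   remains is the finite weighted norm of [f]. *)
apply: (@le_lt_trans _ _
    (\int[mu]_(t in xsection E x) ((vabs x `^ (- g2))%:E * (`|f t| `^ q * W t)%:E))%E).
  apply: le_integral_EFin; first exact: mX.
  - apply: measurable_funTS; apply: (measurableT_comp (measurable_powR _)).
    apply: measurable_funM; first exact: measurableT_comp.
    rewrite (_ : (fun t => (h t)^-1) = fun t => vabs t `^ (- sigma)); first exact: mvabs.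
    by apply/funext => t; rewrite powRN.
  - apply: measurable_funTS; apply: measurable_funM; last exact: mfW.
    exact: measurable_cst.
  - by move=> t _; exact: powR_ge0.
  - move=> t; rewrite /xsection /= => /set_mem Ext; have [_ t0] := E0 _ _ Ext.
    have -> : (`|f t| / h t) `^ q = vabs t `^ (- g2) * (`|f t| `^ q * W t).
      rewrite powRM ?invr_ge0 // -powRN -powRrM mulrCA /W pD //.
      by congr (_ * _ `^ _); rewrite g2E opprD mulNr subrK.
    by apply: ler_wpM2r; [exact: fW0|exact: mono Ext].
rewrite ge0_integralZl_EFin ?powR_ge0 //; first last.
- exact/measurable_EFinP/measurable_funTS.
- by move=> t _; rewrite lee_fin.
apply: lte_mul_pinfty => //; first by rewrite lee_fin powR_ge0.
apply: le_lt_trans (lty_poweRy _ f_fin); last by rewrite invr_neq0 // gt_eqF.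
apply: ge0_subset_integral => //; last by move=> t _; rewrite lee_fin.
exact/measurable_EFinP.
Qed.



(** The pointwise bound is raised to the power [q], integrated against the weight and combined with
    the Schur estimate; the [q]-th root gives the constant (K^q C)^(1/q). *)
Lemma weighted_bounded_kernel (E : set (V * V)) (a c C K : R)
    (D : (V -> R) -> V -> Prop) (T : (V -> R) -> V -> R) :
  measurable E -> 0 <= C -> 0 <= K ->
  (forall f : V -> R, weighted_L mu q alpha f ->
    (\int[mu]_x (((osc x * vabs x `^ a) `^ q * vabs x `^ alpha)%:E *
      (\int[mu]_(t in xsection E x) (osc t * vabs t `^ c * `|f t|)%:E) `^ q) <=
     C%:E * \int[mu]_x (`|f x| `^ q * vabs x `^ alpha)%:E)%E) ->
  (forall f : V -> R, weighted_L mu q alpha f ->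
    [/\ forall x, x != 0 -> D f x, measurable_fun setT (T f) &
    forall x, x != 0 -> ((`|T f x|)%:E <= (K * (osc x * vabs x `^ a))%:E *
      \int[mu]_(t in xsection E x) (osc t * vabs t `^ c * `|f t|)%:E)%E]) ->
  weighted_bounded mu q alpha D T.
Proof.
move=> mE C0 K0 hC hT; exists ((K `^ q * C) `^ q^-1) => f fL.
have [mf f_fin] := fL; have [Df mT Tf] := hT f fL.
pose I x := (\int[mu]_(t in xsection E x) (osc t * vabs t `^ c * `|f t|)%:E)%E.
have g0 t : 0 <= osc t * vabs t `^ c * `|f t| by rewrite !mulr_ge0 ?powR_ge0.
have I0 x : (0 <= I x)%E by apply: integral_ge0 => t _; rewrite lee_fin.
have mI : measurable_fun setT I.
  have mg : measurable_fun setT (fun t => osc t * vabs t `^ c * `|f t|).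
    by apply: measurable_funM; [exact: measurable_funM|exact: measurableT_comp].
  exact: (measurable_section_integral (haar_sigma_finite haar) mE mg g0).1.
pose w x := (osc x * vabs x `^ a) `^ q * vabs x `^ alpha.
have w0 x : 0 <= w x by rewrite mulr_ge0 ?powR_ge0.
have mw : measurable_fun setT w.
  apply: measurable_funM; last exact: mvabs.
  apply: (measurableT_comp (measurable_powR _)).
  by apply: measurable_funM; last exact: mvabs.
have mwI : measurable_fun setT (fun x => (w x)%:E * I x `^ q)%E.
  apply: emeasurable_funM; first exact/measurable_EFinP.
  exact: (measurableT_comp (measurable_poweR _)).
have mTW : measurable_fun setT (fun x => `|T f x| `^ q * vabs x `^ alpha).
  apply: measurable_funM; last exact: mvabs.
  by apply: (measurableT_comp (measurable_powR _)); exact: measurableT_comp.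
have main : (\int[mu]_x (`|T f x| `^ q * vabs x `^ alpha)%:E <=
    (K `^ q * C)%:E * \int[mu]_x (`|f x| `^ q * vabs x `^ alpha)%:E)%E.
  pose Z : set V := [set 0].
  have m0 : measurable Z by exact: measurable_point0.
  (* The pointwise bound holds only off the origin, which is a null set. *)
  rewrite (ge0_negligible_integral m0 measurableT _ _ (haar_point0 haar n_gt0)); first last.
  - by move=> x _; rewrite lee_fin mulr_ge0 ?powR_ge0.
  - exact/measurable_EFinP.
  rewrite EFinM -muleA.
  apply: le_trans (lee_wpmul2l _ (hC f fL)); last by rewrite lee_fin powR_ge0.
  rewrite -ge0_integralZl_EFin ?powR_ge0 //; last first.
    by move=> x _; apply: mule_ge0; [rewrite lee_fin; exact: w0|exact: poweR_ge0].
  apply: (@le_trans _ _ (\int[mu]_(x in [set: V] `\` Z) ((K `^ q)%:E * ((w x)%:E * I x `^ q)))%E).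
    apply: ge0_le_integral.
    - exact: measurableD.
    - by move=> x _; rewrite lee_fin mulr_ge0 ?powR_ge0.
    - exact/measurable_EFinP/measurable_funTS.
    - by apply: measurable_funTS; exact: measurable_funeM.
    move=> x [_ /eqP x0].
    have := Tf x x0; rewrite -/(I x) => h.
    have {}h : ((`|T f x| `^ q)%:E <= (K `^ q * (osc x * vabs x `^ a) `^ q)%:E * I x `^ q)%E.
      rewrite -powRM ?mulr_ge0 ?powR_ge0 // -poweR_EFin -poweR_EFin -poweRM //; last first.
        by rewrite lee_fin !mulr_ge0 ?powR_ge0.
      apply: gt0_ler_poweR => //; first exact: ltW.
      - by rewrite in_itv /= leey andbT lee_fin.
      - by rewrite in_itv /= leey andbT mule_ge0 // lee_fin !mulr_ge0 ?powR_ge0.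
    rewrite EFinM; apply: le_trans (lee_wpmul2r _ h) _; first by rewrite lee_fin powR_ge0.
    rewrite le_eqVlt; apply/orP; left; apply/eqP.
    by rewrite muleAC -EFinM muleA -EFinM mulrA.
  apply: ge0_subset_integral => //.
  - exact: measurableD.
  - exact: measurable_funeM.
  - by move=> x _; rewrite !mule_ge0 ?lee_fin ?powR_ge0 ?poweR_ge0.
have wn : (weighted_norm mu q alpha (T f) <=
    ((K `^ q * C) `^ q^-1)%:E * weighted_norm mu q alpha f)%E.
  rewrite /weighted_norm -poweR_EFin -poweRM; last 2 first.
  - by rewrite lee_fin mulr_ge0 ?powR_ge0.
  - by apply: integral_ge0 => x _; rewrite lee_fin mulr_ge0 ?powR_ge0.
  apply: gt0_ler_poweR; last exact: main.
  - by rewrite invr_ge0 ltW.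
  - rewrite in_itv /= leey andbT; apply: integral_ge0 => x _.
    by rewrite lee_fin mulr_ge0 ?powR_ge0.
  - rewrite in_itv /= leey andbT mule_ge0 ?lee_fin ?mulr_ge0 ?powR_ge0 //.
    by apply: integral_ge0 => x _; rewrite lee_fin mulr_ge0 ?powR_ge0.
split; [exact: Df| |exact: wn]; split; first exact: mT.
apply: le_lt_trans wn _; apply: lte_mul_pinfty => //.
by rewrite lee_fin powR_ge0.
Qed.

Let mle : measurable padic_le. Proof. exact: measurable_padic_le. Qed.
Let mge : measurable padic_ge. Proof. exact: measurable_padic_ge. Qed.
Let osc_ge1 x : 1 <= osc x. Proof. exact: oscillation_ge1. Qed.

Let mweight c (f : V -> R) : measurable_fun setT f ->
  measurable_fun setT (fun t => osc t * vabs t `^ c * `|f t|).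
Proof.
by move=> mf; apply: measurable_funM; [exact: measurable_funM|exact: measurableT_comp].
Qed.

Let powR_ratio_ge1 (e y z : R) : 0 < e -> 0 < y -> y <= z -> 1 <= z `^ e * y `^ (- e).
Proof.
move=> e0 y0 yz; rewrite powRN -ler_pdivrMr ?invr_gt0 ?powR_gt0 // invrK mul1r.
have z0 := lt_le_trans y0 yz.
by apply: ge0_ler_powR; rewrite ?nnegrE ?(ltW e0) ?(ltW y0) ?(ltW z0).
Qed.

Let powRB_abs (x : V) (e : R) : x != 0 ->
  vabs x `^ (e - n%:R) = vabs x `^ e * (vabs x ^+ n)^-1.
Proof.
move=> x0; rewrite powRB; last by apply/implyP => _; rewrite Qpn_abs_eq0.
by rewrite powR_mulrn // Qpn_abs_ge0.
Qed.

(** The factor |x|^(-n) of the operator and the factor (|x|/|t|)^e of [CMO_difference] give a = e -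
    n and c = -e; the hypothesis on alpha is exactly the positivity of [dl]. *)
Lemma commutator_hardy_bounded : alpha < n%:R * q / q' ->
  weighted_bounded mu q alpha (commutator_defined b (hardy_defined mu))
    (commutator b (hardy mu)).
Proof.
move=> al; pose dl := n%:R / q' - alpha / q.
have dl0 : 0 < dl.
  by rewrite subr_gt0 ltr_pdivrMr // mulrAC.
(* With this choice the exponents of the two Schur conditions are [e * q' > 0]
   over balls and [- e * q < 0] over their complements. *)
pose e := dl / 3; pose sigma := - (alpha / q) - e.
have e0 : 0 < e by rewrite divr_gt0.
have [C0 C00 hC0] := CMO_difference haar max_ge1 b_CMO e0.
have [C C_ge0 hC] : exists2 C : R, 0 <= C & forall f : V -> R, weighted_L mu q alpha f ->
    (forall x, \int[mu]_(t in xsection padic_le x)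
       (osc t * vabs t `^ (- e) * `|f t|)%:E < +oo)%E /\
    (\int[mu]_x (((osc x * vabs x `^ (e - n%:R)) `^ q * vabs x `^ alpha)%:E *
      (\int[mu]_(t in xsection padic_le x) (osc t * vabs t `^ (- e) * `|f t|)%:E) `^ q) <=
     C%:E * \int[mu]_x (`|f x| `^ q * vabs x `^ alpha)%:E)%E.
  have g1E : e * q' = (- e + sigma) * q' + n%:R.
    by rewrite /sigma /e /dl; field; rewrite !lt0r_neq0.
  have g2E : - (e * q) = sigma * q + alpha.
    by rewrite /sigma; field; rewrite lt0r_neq0.
  apply: (osc_kernel_bound mle _ _ g1E g2E).
  - by move=> x t; rewrite /padic_le /= => /andP[t0 /(lt_le_trans t0)].
  - by rewrite addrC addKr.
  - have := osc_inner q'_gt0 _ (mulr_gt0 e0 q'_gt0).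
    rewrite le_max lexx => /(_ isT)[A A0 hA]; exists A; first exact: A0.
    by move=> x; rewrite xsection_padic_le; exact: hA.
  - have := @osc_outer q (- (e * q)) q_gt0.
    rewrite le_max lexx orbT oppr_lt0 mulr_gt0 // => /(_ isT isT)[B B0 hB].
    by exists B; [exact: B0|move=> x; rewrite ysection_padic_le; exact: hB].
  - move=> x t; rewrite /padic_le /= opprK => /andP[t0 tx].
    by apply: ge0_ler_powR; rewrite ?nnegrE ?Qpn_abs_ge0 // mulr_ge0 // ltW.
apply: (weighted_bounded_kernel (a := e - n%:R) mle C_ge0 C00).
  by move=> f fL; have [_ h] := hC f fL; exact: h.
move=> f fL; have [Ifin _] := hC f fL; have mf := fL.1.
pose I x := (\int[mu]_(t in xsection padic_le x) (osc t * vabs t `^ (- e) * `|f t|)%:E)%E.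
have key x : x != 0 -> [/\ mu.-integrable (Qpn_ball (vabs x)) (EFin \o f),
    mu.-integrable (Qpn_ball (vabs x)) (EFin \o (fun t => b t * f t)) &
    ((`|b x * \int[mu]_(t in Qpn_ball (vabs x)) f t -
        \int[mu]_(t in Qpn_ball (vabs x)) (b t * f t)|)%:E
      <= (C0 * vabs x `^ e * osc x)%:E * I x)%E].
  move=> x0; have vx0 : 0 < vabs x by rewrite Qpn_abs_gt0.
  have [k xk] := Qpn_abs_value R x0.
  have mD : measurable (Qpn_ball (vabs x) : set V).
    by rewrite xk; exact: measurable_padic_ball.
  have mS := measurable_xsection x mle.
  apply: (kernel_integral_bound (c1 := vabs x `^ e) mD mS _ mf (mweight (- e) mf) mb).
  - rewrite (_ : _ `\` _ = [set 0]) ?haar_point0 // xsection_padic_le.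
    apply/seteqP; split => t; rewrite /inner /Qpn_ball /=.
      move=> [tx /negP]; rewrite tx andbT -leNgt => t0.
      by apply/eqP; rewrite -(Qpn_abs_eq0 R) eq_le t0 Qpn_abs_ge0.
    by move=> ->; rewrite Qpn_abs0 ltxx ltW.
  - by move=> t; rewrite !mulr_ge0 ?powR_ge0.
  - exact: Ifin.
  - by rewrite !mulr_ge0 ?powR_ge0.
  (* Convergence of the uncommuted integral costs nothing extra: both phi(t) and (|x|/|t|)^e are at
     least 1. *)
  - move=> t; rewrite xsection_padic_le /inner /= => /andP[t0 tx].
    rewrite mulrA ler_peMl // mulrCA mulr_ege1 //.
    exact: powR_ratio_ge1.
  - move=> t; rewrite xsection_padic_le /inner /= => /andP[t0 tx].
    rewrite Qpn_abs_gt0 in t0.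
    rewrite mulrA ler_wpM2r //; apply: le_trans (hC0 x t t0 tx) _.
    have alg (u v w y z : R) : u * (v * w) * (y * z) = u * v * y * (z * w) by ring.
    by rewrite alg.
split.
- by move=> x /key[iF ibF _]; split; [exact: iF|exact: ibF].
- have mrad (g : V -> R) : measurable_fun setT (hardy mu g).
    exact: (measurable_radial
      (fun r => (r ^+ n)^-1 * \int[mu]_(t in Qpn_ball r) g t)).
  by apply: measurable_funB => //; exact: measurable_funM.
- move=> x x0; have [_ _ h] := key x x0.
  have rn0 : 0 <= (vabs x ^+ n)^-1 by rewrite invr_ge0 exprn_ge0 // Qpn_abs_ge0.
  have -> : commutator b (hardy mu) f x = (vabs x ^+ n)^-1 *
      (b x * \int[mu]_(t in Qpn_ball (vabs x)) f t -
       \int[mu]_(t in Qpn_ball (vabs x)) (b t * f t)).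
    by rewrite /commutator /hardy mulrBr mulrCA.
  rewrite normrM (ger0_norm rn0) EFinM.
  apply: le_trans (lee_wpmul2l _ h) _; first by rewrite lee_fin.
  rewrite muleA -EFinM powRB_abs // -/(I x) le_eqVlt; apply/orP; left; apply/eqP.
  by congr (_%:E * _)%E; ring.
Qed.

(** Balls and complements exchange roles, and |t|^(-n) now belongs to the inner variable: a = -e and
    c = e - n. *)
Lemma commutator_hardy_dual_bounded : - n%:R < alpha ->
  weighted_bounded mu q alpha (commutator_defined b (hardy_dual_defined mu))
    (commutator b (hardy_dual mu)).
Proof.
move=> al; pose dl := (n%:R + alpha) / q.
have dl0 : 0 < dl by rewrite divr_gt0 // -ltrBlDl sub0r.
(* One third of [dl] is lost in [c], one in sigma, and one remains as decay: the Schur exponents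
   become -(e q') over complements of balls and e q over balls. *)
pose e := dl / 3; pose sigma := - (alpha / q) + e.
have e0 : 0 < e by rewrite divr_gt0.
have [C0 C00 hC0] := CMO_difference haar max_ge1 b_CMO e0.
have [C C_ge0 hC] : exists2 C : R, 0 <= C & forall f : V -> R, weighted_L mu q alpha f ->
    (forall x, \int[mu]_(t in xsection padic_ge x)
       (osc t * vabs t `^ (e - n%:R) * `|f t|)%:E < +oo)%E /\
    (\int[mu]_x (((osc x * vabs x `^ (- e)) `^ q * vabs x `^ alpha)%:E *
      (\int[mu]_(t in xsection padic_ge x) (osc t * vabs t `^ (e - n%:R) * `|f t|)%:E) `^ q) <=
     C%:E * \int[mu]_x (`|f x| `^ q * vabs x `^ alpha)%:E)%E.
  have g1E : - (e * q') = (e - n%:R + sigma) * q' + n%:R.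
    have qV : q^-1 = 1 - q'^-1 by rewrite -qq' addrK.
    by rewrite /sigma /e /dl qV; field; rewrite lt0r_neq0.
  have g2E : e * q = sigma * q + alpha.
    by rewrite /sigma; field; rewrite lt0r_neq0.
  apply: (osc_kernel_bound mge _ _ g1E g2E).
  - by move=> x t; rewrite /padic_ge /= => /andP[x0 xt]; split => //; exact: lt_le_trans xt.
  - by rewrite addKr.
  - have := @osc_outer q' (- (e * q')) q'_gt0.
    rewrite le_max lexx oppr_lt0 mulr_gt0 // => /(_ isT isT)[A A0 hA].
    by exists A; [exact: A0|move=> x; rewrite xsection_padic_ge; exact: hA].
  - have := @osc_inner q (e * q) q_gt0.
    rewrite le_max lexx orbT mulr_gt0 // => /(_ isT isT)[B B0 hB].
    by exists B; [exact: B0|move=> x; rewrite ysection_padic_ge; exact: hB].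
  - move=> x t; rewrite /padic_ge /= => /andP[x0 xt].
    apply: ler_powRN; [by rewrite mulr_ge0 // ltW|exact: x0|exact: xt].
apply: (weighted_bounded_kernel (a := - e) mge C_ge0 C00).
  by move=> f fL; have [_ h] := hC f fL; exact: h.
move=> f fL; have [Ifin _] := hC f fL; have mf := fL.1.
pose I x := (\int[mu]_(t in xsection padic_ge x) (osc t * vabs t `^ (e - n%:R) * `|f t|)%:E)%E.
pose D x : set V := ~` Qpn_ball (vabs x).
pose F t := f t / vabs t ^+ n.
have mF : measurable_fun setT F.
  by apply: measurable_funM => //; exact: (measurable_radial (fun r => (r ^+ n)^-1)).
have bF : (fun t => b t * F t) = (fun t => b t * f t / vabs t ^+ n).
  by apply/funext => t; rewrite /F mulrA.
have key x : x != 0 -> [/\ mu.-integrable (D x) (EFin \o F),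
    mu.-integrable (D x) (EFin \o (fun t => b t * F t)) &
    ((`|b x * \int[mu]_(t in D x) F t - \int[mu]_(t in D x) (b t * F t)|)%:E
      <= (C0 * vabs x `^ (- e) * osc x)%:E * I x)%E].
  move=> x0; have vx0 : 0 < vabs x by rewrite Qpn_abs_gt0.
  have [k xk] := Qpn_abs_value R x0.
  have mD : measurable (D x).
    by rewrite /D xk; apply: measurableC; exact: measurable_padic_ball.
  have mS := measurable_xsection x mge.
  have Fabs t : vabs x <= vabs t ->
      `|F t| * vabs t `^ e = vabs t `^ (e - n%:R) * `|f t|.
    move=> xt; have t0 : t != 0 by rewrite -(Qpn_abs_gt0 R) (lt_le_trans vx0).
    have rn : `|(vabs t ^+ n)^-1| = (vabs t ^+ n)^-1.
      by rewrite ger0_norm // invr_ge0 exprn_ge0 // Qpn_abs_ge0.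
    by rewrite (powRB_abs _ t0) /F normrM rn mulrAC [`|f t| * _]mulrC mulrAC.
  apply: (kernel_integral_bound (c1 := vabs x `^ (- e)) mD mS _ mF (mweight (e - n%:R) mf) mb).
  - rewrite (_ : _ `\` _ = set0) ?measure0 // xsection_padic_ge.
    apply/seteqP; split => t //; rewrite /outer /D /Qpn_ball /=.
    move=> [/negP tx]; rewrite -ltNge in tx; rewrite vx0 /= => /negP.
    by rewrite (ltW tx).
  - by move=> t; rewrite !mulr_ge0 ?powR_ge0.
  - exact: Ifin.
  - by rewrite !mulr_ge0 ?powR_ge0.
  - move=> t; rewrite xsection_padic_ge /outer /= => /andP[_ xt].
    have P := mulr_ege1 (osc_ge1 t) (powR_ratio_ge1 e0 vx0 xt).
    have := ler_peMr (normr_ge0 (F t)) P.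
    have alg (u v w y : R) : w * (v * (y * u)) = u * (v * (w * y)) by ring.
    by rewrite alg (Fabs t xt) [osc t * (_ * _)]mulrA.
  - move=> t; rewrite xsection_padic_ge /outer /= => /andP[_ xt].
    (* Here [t] is the point of larger norm, so [CMO_difference] is applied with its two points
       exchanged. *)
    have h2 := ler_wpM2r (normr_ge0 (F t)) (hC0 t x x0 xt).
    have alg (u v w y z s : R) :
      u * (v * w) * (y * z) * s = u * w * z * (y * (s * v)) by ring.
    by rewrite alg (Fabs t xt) [osc t * (_ * _)]mulrA distrC in h2.
split.
- move=> x /key[iF ibF _]; split; first exact: iF.
  rewrite /hardy_dual_defined.
  by rewrite -[X in mu.-integrable _ X]/(EFin \o (fun t => b t * f t / vabs t ^+ n)) -bF.
(* At [x] the operator depends on the norm of [x] alone, so it is measurable even for those [g]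
   whose integral diverges. *)
- have mrad (g : V -> R) : measurable_fun setT (hardy_dual mu g).
    exact: (measurable_radial
      (fun r => \int[mu]_(t in ~` Qpn_ball r) (g t / vabs t ^+ n))).
  by apply: measurable_funB => //; exact: measurable_funM.
- move=> x x0; have [_ _ h] := key x x0.
  have -> : commutator b (hardy_dual mu) f x =
      b x * \int[mu]_(t in D x) F t - \int[mu]_(t in D x) (b t * F t).
    by rewrite bF.
  apply: le_trans h _; rewrite -/(I x) le_eqVlt; apply/orP; left; apply/eqP.
  by congr (_%:E * _)%E; ring.
Qed.

End weighted_estimates.

Theorem corollary3p1 (R : realType) (p : nat) (pr : prime p) (n : nat)
    (mu : {measure set (Qpn pr n) -> \bar R}) (alpha q q' : R)
    (b : Qpn pr n -> R) :
  (0 < n)%N ->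
  normalized_haar mu ->
  1 < q ->
  q^-1 + q'^-1 = 1 ->
  CMO mu (Num.max q' q) b ->
  (alpha < n%:R * q / q' ->
     weighted_bounded mu q alpha (commutator_defined b (hardy_defined mu))
       (commutator b (hardy mu)))
  /\
  (- n%:R < alpha ->
     weighted_bounded mu q alpha (commutator_defined b (hardy_dual_defined mu))
       (commutator b (hardy_dual mu))).
Proof.
move=> n0 haar q1 qq' b_CMO; split=> al.
- exact: (commutator_hardy_bounded n0 haar q1 qq' b_CMO al).
- exact: (commutator_hardy_dual_bounded n0 haar q1 qq' b_CMO al).
Qed.
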